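(* Let $C$ be a smooth projective algebraic curve of genus $g$ over $\mathbb{C}$, and let $B^2_{n,d}$ be the Brill-Noether scheme of stable bundles of rank $n$ and degree $d$ on $C$ with at least two independent sections. The Petri map $$H^0(E)\otimes H^0(K\otimes E^* )\rightarrow H^0(K\otimes E\otimes E^* )$$ is injective at the bundles $E\in B^2_{n,d}$ which are of second type. Therefore $$\operatorname{Sing} B^2_{n,d}\subseteq B^3_{n,d}\cup\mathcal{E}_1,$$ where $\mathcal{E}_1$ denotes the set of bundles $E\in B^2_{n,d}$ of first type.
   Context: $K$ is the canonical line bundle of $C$. $U(n,d)$ denotes the moduli space of stable vector bundles of rank $n$ and degree $d$ on $C$. For an integer $k$ with $1\leq k\leq n+\frac{d}{2}$, $B^k_{n,d}=\{E\in U(n,d)\mid h^0(E)\geq k\}$ with its natural structure of closed subscheme of $U(n,d)$; at $E\in B^k_{n,d}\setminus B^{k+1}_{n,d}$ its tangent space is the orthogonal of the image of the Petri map $H^0(E)\otimes H^0(K\otimes E^* )\to H^0(K\otimes E\otimes E^* )$. A vector bundle $E$ with $h^0(E)=k\geq 1$ is of first type if it admits an extension $0\to\mathcal{O}(D)\to E\to F\to 0$ with $F$ a vector bundle of rank $\operatorname{rk}E-1$, $D$ an effective divisor and $h^0(\mathcal{O}(D))=k$; otherwise it is of second type.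
   Formalization: Injectivity of the Petri map is stated only for second-type E in B^2 outside B^3 (h^0(E)=2); it fails for some second-type E with h^0(E)=3, e.g. T_{P^2}(-1) restricted to a smooth plane curve of degree at least 5. *)

(* Defs.v *)
From HB Require Import structures.
From mathcomp Require Import all_boot all_order all_algebra.
From mathcomp Require Import all_classical reals.
From mathcomp Require Import complex mxtens.
Set Implicit Arguments.
Unset Strict Implicit.
Unset Printing Implicit Defensive.
Import Order.TTheory GRing.Theory Num.Theory.
Local Open Scope classical_set_scope.
Local Open Scope ring_scope.

(* Conventions.  A smooth projective curve over an algebraically closed field
   F is the abstract nonsingular curve of its function field (Hartshorne, I.6):
   its closed points are the discrete valuations of the function field that
   are trivial on F.  A vector bundle of rank n is given, after a choice of
   basis of its generic stalk, by its stalks, which are lattices in the space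
   of row vectors.  Row vectors are used throughout, so morphisms of bundles
   are given on generic stalks by x |-> x *m S. *)

Section FunctionFields.
Variable F : fieldType.

Definition is_function_field (K : fieldType) (cst : {rmorphism F -> K}) :=
  exists x : K,
    (forall p : {poly F}, p != 0 -> (map_poly cst p).[x] != 0) /\
    exists m (b : 'I_m -> K), forall z : K,
      exists (q : {poly F}) (p : 'I_m -> {poly F}),
        q != 0 /\
        z * (map_poly cst q).[x] = \sum_(i < m) (map_poly cst (p i)).[x] * b i.

Record curve := Curve {
  fnfield :> fieldType;
  cst : {rmorphism F -> fnfield};
  curveP : is_function_field cst }.

(* The value at 0 is a dummy; with this choice the valuation ring is
   [set x | 0 <= pval v x]. *)
Record place (C : curve) := Place {
  pval :> C -> int;
  pval0 : pval 0 = 0;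
  pvalM : forall x y, x != 0 -> y != 0 -> pval (x * y) = pval x + pval y;
  pvalD : forall x y, x != 0 -> y != 0 -> x + y != 0 ->
    Num.min (pval x) (pval y) <= pval (x + y);
  pval_cst : forall c, pval (cst C c) = 0;
  pval_onto : exists t, pval t = 1 }.

End FunctionFields.

Arguments cst {F} _.

HB.instance Definition _ (F : fieldType) (C : curve F) := gen_eqMixin (place C).
HB.instance Definition _ (F : fieldType) (C : curve F) :=
  gen_choiceMixin (place C).

Definition Oring (F : fieldType) (C : curve F) (p : place C) : set C :=
  [set x | 0 <= pval p x].

(* Linear algebra over S in the subquotient U / W of a T-module V, where S
   acts through sigma : S -> T. *)
Section Subquotients.
Variables (S T : nzRingType) (sigma : {rmorphism S -> T}) (V : lmodType T).
Variables U W : set V.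

Definition comb q (c : 'I_q -> S) (s : 'I_q -> V) : V :=
  \sum_(i < q) sigma (c i) *: s i.

Definition free_mod q (s : 'I_q -> V) :=
  forall c : 'I_q -> S, W (comb c s) -> forall i, c i = 0.

Definition generates q (s : 'I_q -> V) :=
  (forall i, U (s i)) /\
  forall u, U u -> exists c : 'I_q -> S, W (u - comb c s).

Definition has_dim k :=
  exists s : 'I_k -> V, generates s /\ free_mod s.

End Subquotients.

(* For a module M = U / W with generators s_1, ..., s_q, the Fitting ideal
   Fitt_j(M) is generated by the minors of size q - j of the matrices whose
   rows are relations between the s_i.  Here j = j1 - j0 may be negative. *)
Definition fitting_zero (S : comNzRingType) (T : nzRingType)
    (sigma : {rmorphism S -> T}) (V : lmodType T) (U W : set V) (j1 j0 : nat) :=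
  forall q m (s : 'I_q -> V) (r : 'M[S]_(m, q)) (f : 'I_m -> 'I_q),
    (m + j1 = q + j0)%N ->
    generates sigma U W s ->
    (forall i, W (comb sigma (r i) s)) ->
    \det (colsub f r) = 0.

(* T is the ring of rational functions and O p the ring of those regular at p;
   this is used for a curve and for its infinitesimal thickenings. *)
Section Bundles.
Variables (P : Type) (T : comNzRingType) (O : P -> set T).

Definition integral (p : P) m n (M : 'M[T]_(m, n)) := forall i j, O p (M i j).

(* The rows of fr p are a basis over O p of the stalk at p. *)
Record bundle (n : nat) := Bundle {
  fr : P -> 'M[T]_n;
  cofr : P -> 'M[T]_n;
  fr_cofr : forall p, fr p *m cofr p = 1%:M;
  bundle_ae :
    finite_set [set p | ~ (integral p (fr p) /\ integral p (cofr p))] }.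

Definition stalk n (E : bundle n) (p : P) : set 'rV[T]_n :=
  [set x | integral p (x *m cofr E p)].

Definition H0 n (E : bundle n) : set 'rV[T]_n :=
  [set x | forall p, stalk E p x].

(* H^1 is the quotient of the adeles (repartitions) by the sum of the generic
   stalk and the product of the stalks, i.e. the cokernel of the map
   E_eta -> (+)_p E_eta / E_p. *)
Definition adeles n : set (P -> 'rV[T]_n) :=
  [set a | finite_set [set p | ~ integral p (a p)]].

Definition H1rel n (E : bundle n) : set (P -> 'rV[T]_n) :=
  [set a | exists x : 'rV[T]_n, forall p, stalk E p (a p - x)].

End Bundles.

(* x |-> x *m H is an isomorphism from psi^* E' onto E. *)
Definition pullback_iso (P : Type) (T' T : comNzRingType)
    (psi : {rmorphism T' -> T}) (O' : P -> set T') (O : P -> set T) n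
    (E' : bundle O' n) (E : bundle O n) :=
  exists H H' : 'M[T]_n,
    H *m H' = 1%:M /\
    forall p,
      integral O p (map_mx psi (fr E' p) *m H *m cofr E p) /\
      integral O p (fr E p *m H' *m map_mx psi (cofr E' p)).

Section CurveBundles.
Variables (F : fieldType) (C : curve F).

Definition vbundle (n : nat) := bundle (@Oring F C) n.

Definition degree n (E : vbundle n) : int :=
  - \sum_(p \in [set: place C]) pval p (\det (fr E p)).

Definition short_exact a b c (E1 : vbundle a) (E2 : vbundle b)
    (E3 : vbundle c) (S : 'M[C]_(a, b)) (Q : 'M[C]_(b, c)) :=
  forall p : place C,
    [/\ forall x, stalk E1 p x -> stalk E2 p (x *m S),
        forall y, stalk E2 p y -> stalk E3 p (y *m Q),
        forall x, stalk E1 p x -> x *m S = 0 -> x = 0,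
        forall y, stalk E2 p y ->
          (y *m Q = 0 <-> exists2 x, stalk E1 p x & y = x *m S) &
        forall z, stalk E3 p z -> exists2 y, stalk E2 p y & z = y *m Q].

Definition stable n (E : vbundle n) :=
  forall a c (E1 : vbundle a) (E3 : vbundle c) S Q,
    (0 < a)%N -> (0 < c)%N -> short_exact E1 E E3 S Q ->
    degree E1 * n%:Z < degree E * a%:Z.

Definition h0_eq n (E : vbundle n) (k : nat) :=
  has_dim (cst C) (H0 E) [set 0] k.

Definition h0_ge n (E : vbundle n) (k : nat) :=
  exists s : 'I_k -> 'rV[C]_n,
    (forall i, H0 E (s i)) /\ free_mod (cst C) [set 0] s.

Definition h1_eq n (E : vbundle n) (k : nat) :=
  has_dim (cst C) (adeles (@Oring F C) (n:=n)) (H1rel E) k.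

Lemma pval1 (p : place C) : pval p 1 = 0.
Proof. by rewrite -(rmorph1 (cst C)) pval_cst. Qed.

Lemma Oring0 (p : place C) : Oring p 0.
Proof. by rewrite /Oring /= pval0. Qed.

Lemma OringM (p : place C) x y : Oring p x -> Oring p y -> Oring p (x * y).
Proof.
rewrite /Oring /=; have [->|x0] := eqVneq x 0; first by rewrite mul0r pval0.
have [->|y0] := eqVneq y 0; first by rewrite mulr0 pval0.
by move=> hx hy; rewrite pvalM // addr_ge0.
Qed.

Lemma integral_tens (p : place C) m n m' n' (A : 'M[C]_(m, n))
    (B : 'M[C]_(m', n')) :
  integral (@Oring F C) p A -> integral (@Oring F C) p B ->
  integral (@Oring F C) p (A *t B).
Proof. by move=> hA hB i j; rewrite mxE; apply: OringM. Qed.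

Section DualTensor.
Variables (m n : nat) (L : vbundle m) (E : vbundle n).

Lemma dual_fr_cofr p : (cofr E p)^T *m (fr E p)^T = 1%:M.
Proof. by rewrite -trmx_mul fr_cofr trmx1. Qed.

Lemma dual_ae : finite_set [set p | ~ (integral (@Oring F C) p (cofr E p)^T /\
                                       integral (@Oring F C) p (fr E p)^T)].
Proof.
apply: sub_finite_set (bundle_ae E) => p /= h [h1 h2]; apply: h.
by split=> i j; rewrite mxE.
Qed.

Definition vdual : vbundle n := Bundle dual_fr_cofr dual_ae.

Lemma tens_fr_cofr p :
  (fr L p *t fr E p) *m (cofr L p *t cofr E p) = 1%:M.
Proof.
rewrite tensmx_mul !fr_cofr; apply/matrixP => i j.
case: (mxtens_indexP i) => i0 i1; case: (mxtens_indexP j) => j0 j1.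
rewrite tensmxE !mxE -natrM mulnb; congr (_%:R); congr nat_of_bool.
apply/andP/eqP => [[/eqP -> /eqP ->] //|].
by move/(can_inj (@mxtens_indexK _ _)) => [-> ->].
Qed.

Lemma tens_ae : finite_set
  [set p | ~ (integral (@Oring F C) p (fr L p *t fr E p) /\
              integral (@Oring F C) p (cofr L p *t cofr E p))].
Proof.
have h := bundle_ae L; have h' := bundle_ae E.
apply: (@sub_finite_set _ _ (_ `|` _)); last by rewrite finite_setU; split;
  [exact: h | exact: h'].
move=> p /= hp; apply: contrapT => /not_orP [/contrapT [a b] /contrapT [c d]].
by apply: hp; split; apply: integral_tens.
Qed.

Definition vtens : vbundle (m * n) := Bundle tens_fr_cofr tens_ae.

End DualTensor.

Record divisor := Divisor {
  mult :> place C -> int;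
  mult_fin : finite_set [set p | mult p != 0] }.

Definition effective (D : divisor) := forall p, 0 <= D p.

Definition unif (p : place C) : C := sval (cid (pval_onto p)).

Lemma unif_neq0 p : unif p != 0.
Proof.
rewrite /unif; case: cid => t /= ht; apply/eqP => t0.
by move: ht; rewrite t0 pval0.
Qed.

Section LineBundle.
Variable D : divisor.

Lemma OD_fr_cofr p :
  (unif p ^ (- D p))%:M *m (unif p ^ D p)%:M = 1%:M :> 'M[C]_1.
Proof. by rewrite -scalar_mxM -expfzDr ?unif_neq0 // addNr expr0z. Qed.

Lemma OD_ae : finite_set
  [set p | ~ (integral (@Oring F C) p ((unif p ^ (- D p))%:M : 'M[C]_1) /\
              integral (@Oring F C) p ((unif p ^ D p)%:M : 'M[C]_1))].
Proof.
apply: sub_finite_set (mult_fin D) => p /= h; apply/eqP => Dp; apply: h.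
rewrite Dp oppr0 expr0z.
by split=> i j; rewrite !ord1 mxE eqxx /Oring /= pval1.
Qed.

(* The stalk at p is the set of f with pval p f >= - D p. *)
Definition OD : vbundle 1 := Bundle OD_fr_cofr OD_ae.

End LineBundle.

Definition derivation (delta : C -> C) :=
  [/\ forall x y, delta (x + y) = delta x + delta y,
      forall x y, delta (x * y) = delta x * y + x * delta y &
      forall c, delta (cst C c) = 0].

(* In characteristic 0 the space of rational differentials of C is
   one-dimensional over the function field, and a nonzero derivation delta
   identifies it with the function field by f dg |-> f * delta g.  The stalk
   at p of the canonical bundle is spanned over O_p by the dg, g in O_p. *)
Definition canonical_bundle (KC : vbundle 1) :=
  exists delta : C -> C,
    [/\ derivation delta, exists x, delta x != 0 &
        forall (p : place C) (w : 'rV[C]_1),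
          stalk KC p w <->
          exists q (f g : 'I_q -> C),
            (forall i, Oring p (f i) /\ Oring p (g i)) /\
            w 0 0 = \sum_(i < q) f i * delta (g i)].

Definition has_genus (g : nat) :=
  exists KC : vbundle 1, canonical_bundle KC /\ h0_eq KC g.

(* The Petri map sends s (x) t to s *t t, with K (x) E (x) E^* written as
   E (x) (K (x) E^* ).  The tensor product of its two factors is the union of
   the tensor products span(s) (x) span(t) for free families s and t; an
   element of the latter is the matrix of its coordinates on the s_i (x) t_j. *)
Definition petri n (a b : nat) (s : 'I_a -> 'rV[C]_n)
    (t : 'I_b -> 'rV[C]_(1 * n)) (c : 'M[F]_(a, b)) : 'rV[C]_(n * (1 * n)) :=
  \sum_(i < a) \sum_(j < b) cst C (c i j) *: (s i *t t j).

Lemma petri_H0 (KC : vbundle 1) n (E : vbundle n) s t :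
  H0 E s -> H0 (vtens KC (vdual E)) t ->
  H0 (vtens E (vtens KC (vdual E))) (s *t t).
Proof.
move=> hs ht p; rewrite /stalk /= => i j.
have -> : (s *t t) *m (cofr E p *t (cofr KC p *t (fr E p)^T)) =
  (s *m cofr E p) *t (t *m (cofr KC p *t (fr E p)^T)) by rewrite tensmx_mul.
by apply: integral_tens; [apply: hs | apply: ht].
Qed.

Definition petri_injective (KC : vbundle 1) n (E : vbundle n) :=
  forall a b (s : 'I_a -> 'rV[C]_n) (t : 'I_b -> 'rV[C]_(1 * n)),
    (forall i, H0 E (s i)) -> free_mod (cst C) [set 0] s ->
    (forall j, H0 (vtens KC (vdual E)) (t j)) -> free_mod (cst C) [set 0] t ->
    injective (petri s t).

Definition first_type n (E : vbundle n) :=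
  exists k : nat,
    [/\ (0 < k)%N, h0_eq E k &
        exists (D : divisor) (E3 : vbundle n.-1) S Q,
          [/\ effective D, h0_eq (OD D) k & short_exact (OD D) E E3 S Q]].

Definition second_type n (E : vbundle n) :=
  (exists2 k : nat, (0 < k)%N & h0_eq E k) /\ ~ first_type E.

(* Points of the moduli space are isomorphism classes; they are represented here
   by bundles, and every predicate below is invariant under isomorphism. *)
Definition moduli n (d : int) : set (vbundle n) :=
  [set E | stable E /\ degree E = d].

Definition brill_noether (k n : nat) (d : int) : set (vbundle n) :=
  [set E | moduli d E /\ h0_ge E k].

(* A local Artinian F-algebra A with residue field F, together with
   A (x)_F K, where K is the function field of C.  The field th_basis says that
   A is finite-dimensional and that A (x)_F K is the tensor product. *)
Record thickening := Thickening {
  th_base : comNzRingType;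
  th_gen : comNzRingType;
  th_str : {rmorphism F -> th_base};
  th_res : {rmorphism th_base -> F};
  th_inj : {rmorphism th_base -> th_gen};
  th_cst : {rmorphism C -> th_gen};
  th_gres : {rmorphism th_gen -> C};
  th_resK : cancel th_str th_res;
  th_nil : forall a, th_res a = 0 -> exists N, a ^+ N = 0;
  th_compat : forall c, th_inj (th_str c) = th_cst (cst C c);
  th_gresK : cancel th_cst th_gres;
  th_gres_inj : forall a, th_gres (th_inj a) = cst C (th_res a);
  th_basis : exists m (e : 'I_m -> th_base),
    (forall a, exists! c : 'rV[F]_m, a = \sum_(i < m) th_str (c 0 i) * e i) /\
    (forall u, exists! x : 'rV[C]_m,
      u = \sum_(i < m) th_cst (x 0 i) * th_inj (e i)) }.

(* A (x)_F O_p *)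
Definition th_Oring (X : thickening) (p : place C) : set (th_gen X) :=
  [set u | exists q (a : 'I_q -> th_base X) (f : 'I_q -> C),
     (forall i, Oring p (f i)) /\
     u = \sum_(i < q) th_inj X (a i) * th_cst X (f i)].

Definition th_bundle (X : thickening) (n : nat) := bundle (@th_Oring X) n.

(* phi : A' -> A is a morphism of F-algebras and psi is phi (x) id. *)
Definition th_morphism (X' X : thickening)
    (phi : {rmorphism th_base X' -> th_base X})
    (psi : {rmorphism th_gen X' -> th_gen X}) :=
  [/\ forall c, phi (th_str X' c) = th_str X c,
      forall a, psi (th_inj X' a) = th_inj X (phi a) &
      forall f, psi (th_cst X' f) = th_cst X f].

(* EX is an A-valued point at E of the scheme B^k.  As stable bundles are
   simple, the A-valued points at E of the moduli space are the deformations of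
   E over A.  The scheme B^k is locally defined, for a complex of locally free
   sheaves K^0 -> K^1 computing the cohomology of the universal bundle, by the
   minors of size rk K^0 - k + 1; this is the Fitting ideal of R^1 of index
   rk K^1 - rk K^0 + k - 1 = h^1(E) - h^0(E) + k - 1. *)
Definition bn_point (k n : nat) (E : vbundle n) (X : thickening)
    (EX : th_bundle X n) :=
  pullback_iso (th_gres X) EX E /\
  forall h0 h1, h0_eq E h0 -> h1_eq E h1 ->
    fitting_zero (th_inj X) (adeles (@th_Oring X) (n:=n)) (H1rel EX)
      (h1 + k) h0.+1.

(* B^k is of finite type over F, so it is smooth at E, or equivalently
   nonsingular there, when its A-valued points at E lift along surjections of
   local Artinian algebras. *)
Definition bn_smooth_at (k n : nat) (E : vbundle n) :=
  forall (X' X : thickening) phi psi,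
    @th_morphism X' X phi psi -> (forall a, exists a', phi a' = a) ->
    forall EX : th_bundle X n, bn_point k E EX ->
    exists2 EX' : th_bundle X' n, bn_point k E EX' & pullback_iso psi EX' EX.

Definition bn_sing (k n : nat) (d : int) : set (vbundle n) :=
  [set E | brill_noether k d E /\ ~ bn_smooth_at k E].

End CurveBundles.

(* Main.v *)
Require Import Defs.
From mathcomp Require Import all_boot all_order all_algebra.
From mathcomp Require Import all_classical reals.
From mathcomp Require Import complex mxtens ring zify.
Set Implicit Arguments.
Unset Strict Implicit.
Unset Printing Implicit Defensive.
Import Defs Order.TTheory GRing.Theory Num.Theory.
Local Open Scope classical_set_scope.
Local Open Scope ring_scope.

(* Let s_1, s_2 be a basis of H^0(E).  If they are proportional over the
   function field, the saturation of O s_1 in E is O(D) with D effective, its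
   sections are those of E, and E is of first type.  Otherwise they are linearly
   independent over the function field, so a relation sum s_i (x) t_i = 0 forces
   t_i = 0: this is the injectivity of the Petri map.

   For the smoothness, the dual form of this injectivity, the surjectivity of
   H^1(End E) -> H^1(E)^2, is made explicit.  A deformation E_A of E over A is a
   point of B^2 exactly when H^1(E_A) is free over A, that is, when s_1 and s_2
   lift to sections of E_A.  The lifts are part of a basis of the generic stalk,
   so along A' -> A one can lift this basis and then the stalks of E_A, which
   are arbitrary lattices subject to containing two given basis vectors.  If
   H^1(E) had no finite basis, the condition defining B^2 would be void and any
   lift of the lattices would do. *)

(** The link between B^k and freeness is an index: if h^0(E) = k, the Fitting ideal has index h^1(E)
    - 1, while h^1(E) lifted classes generate H^1(E_A), so the ideal contains all coefficients of
    relations between them. A is an arbitrary local Artinian algebra and no chain of small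
    extensions is chosen. Instead, statements over A are reduced to H^1(E) through leading
    coefficients along an F-basis of A whose tails span ideals. A curve is given only by its
    function field and places. That a rational function has finitely many zeros is therefore proved,
    by a dimension count; otherwise the saturation would not be known to be a bundle. Finiteness of
    h^1(E) is left undecided. *)

Section Subquotients.
Variables (S T : nzRingType) (sigma : {rmorphism S -> T}) (V : lmodType T).
Implicit Types U W : set V.

Definition submodule W :=
  [/\ W 0, forall u v, W u -> W v -> W (u + v) &
      forall a u, W u -> W (sigma a *: u)].

Lemma submoduleN W u : submodule W -> W u -> W (- u).
Proof. by move=> [_ _ WZ] /(WZ (-1)); rewrite rmorphN rmorph1 scaleN1r. Qed.

Lemma submoduleB W u v : submodule W -> W u -> W v -> W (u - v).
Proof. by move=> sW Wu Wv; have [_ WD _] := sW; apply: WD => //;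
  exact: submoduleN. Qed.

Lemma submodule_sum W (I : finType) (u : I -> V) :
  submodule W -> (forall i, W (u i)) -> W (\sum_i u i).
Proof. move=> [W0 WD _] Wu; apply: (big_ind W) => [||i _];
  [exact: W0|exact: WD|exact: Wu]. Qed.

Lemma combZ q a (c : 'I_q -> S) (s : 'I_q -> V) :
  sigma a *: comb sigma c s = comb sigma (fun i => a * c i) s.
Proof.
by rewrite scaler_sumr; apply: eq_bigr => i _; rewrite rmorphM scalerA.
Qed.

Lemma comb_suml q (I : finType) (c : I -> 'I_q -> S) (s : 'I_q -> V) :
  comb sigma (fun j => \sum_i c i j) s = \sum_i comb sigma (c i) s.
Proof.
rewrite exchange_big; apply: eq_bigr => j _.
by rewrite rmorph_sum scaler_suml.
Qed.

Lemma combB q (c c' : 'I_q -> S) (s : 'I_q -> V) :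
  comb sigma (fun j => c j - c' j) s = comb sigma c s - comb sigma c' s.
Proof. by rewrite -sumrB; apply: eq_bigr => j _; rewrite rmorphB scalerBl. Qed.

Lemma comb_delta q (i : 'I_q) (s : 'I_q -> V) :
  comb sigma (fun j => (i == j)%:R) s = s i.
Proof.
rewrite /comb (bigD1 i) //= eqxx rmorph1 scale1r big1 ?addr0 // => j.
by rewrite eq_sym => /negPf ->; rewrite rmorph0 scale0r.
Qed.

Lemma comb_mulmx q h (c : 'I_q -> S) (P : 'I_q -> 'I_h -> S) (e : 'I_h -> V) :
  comb sigma (fun j => \sum_i c i * P i j) e =
  \sum_i sigma (c i) *: comb sigma (P i) e.
Proof. by rewrite comb_suml; apply: eq_bigr => i _; rewrite combZ. Qed.

Lemma generates_family U W q (s : 'I_q -> V) (I : Type) (u : I -> V) :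
  generates sigma U W s -> (forall i, U (u i)) ->
  exists c : I -> 'I_q -> S, forall i, W (u i - comb sigma (c i) s).
Proof.
move=> [_ gs] Uu; have /choice [c hc] i := gs _ (Uu i).
by exists c.
Qed.

End Subquotients.

(** Padding by zeros makes both factors square, and the first one then has a zero column. *)
Lemma det_mulmx_thin (S : comNzRingType) q b
    (A : 'M[S]_(q + b.+1, q)) (B : 'M[S]_(q, q + b.+1)) :
  \det (A *m B) = 0.
Proof.
have -> : A *m B = row_mx A (0 : 'M_(_, b.+1)) *m col_mx B 0.
  by rewrite mul_row_col mul0mx addr0.
rewrite det_mulmx (expand_det_col _ (rshift q ord0)) big1 ?mul0r // => i _.
by rewrite row_mxEr mxE mul0r.
Qed.

(* If P and Q express two families of generators in terms of each other, then
   Q P = 1, and r P = 0 for a matrix r of relations, so that the product of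
   (r; Q) with (f | P), which factors through dimension q, is block triangular
   with determinant the minor det r_f. *)
Lemma free_fitting_zero (S : comNzRingType) (T : nzRingType)
    (sigma : {rmorphism S -> T}) (V : lmodType T) (U W : set V) h
    (e : 'I_h -> V) j1 j0 :
  submodule sigma W -> generates sigma U W e -> free_mod sigma W e ->
  (j1 < j0 + h)%N -> fitting_zero sigma U W j1 j0.
Proof.
move=> sW ge fe jh q m s r f mq gs rel; have [_ WD WZ] := sW.
have [P hP] := generates_family ge (proj1 gs).
have [Q hQ] := generates_family gs (proj1 ge).
pose Pm : 'M_(q, h) := \matrix_(i, j) P i j.
pose Qm : 'M_(h, q) := \matrix_(i, j) Q i j.
have WP (c : 'I_q -> S) : W (comb sigma c s - comb sigma (fun j =>
  \sum_i c i * P i j) e).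
  rewrite comb_mulmx -sumrB; apply: submodule_sum sW _ => i.
  by rewrite -scalerBr; apply: WZ.
have QP : Qm *m Pm = 1%:M.
  apply/matrixP => i j; rewrite !mxE; under eq_bigr do rewrite !mxE.
  apply/eqP; rewrite -subr_eq0; apply/eqP.
  move: j; apply: fe; rewrite combB comb_delta.
  rewrite -opprB; apply: (submoduleN sW).
  by have := WD _ _ (hQ i) (WP (Q i)); rewrite addrA subrK.
have rP : r *m Pm = 0.
  apply/matrixP => i j; rewrite !mxE; under eq_bigr do rewrite !mxE.
  move: j; apply: fe.
  by have := submoduleB sW (rel i) (WP (r i)); rewrite opprB addrC subrK.
have : \det (col_mx r Qm *m row_mx (colsub f 1%:M) Pm) = 0.
  (* The product has size [m + h], which exceeds [q] by [j0 + h - j1]; the bound on [j1] says that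
     this is positive. *)
  have [b mhb] : exists b, (m + h = q + b.+1)%N.
    by exists (m + h - q).-1; lia.
  move: (col_mx _ _) (row_mx _ _); rewrite mhb; exact: det_mulmx_thin.
rewrite mul_col_row QP rP det_lblock det1 mulr1.
by rewrite mulmx_colsub mulmx1.
Qed.

Section FieldRank.
Variables (F : fieldType) (T : nzRingType) (sigma : {rmorphism F -> T}).
Variables (V : lmodType T) (U : set V).

Lemma exists_left_kernel m q (M : 'M[F]_(m, q)) :
  (q < m)%N -> exists2 v : 'rV_m, v != 0 & v *m M = 0.
Proof.
move=> qm; exists (nz_row (kermx M)); last first.
  by apply/sub_kermxP; exact: nz_row_sub.
rewrite nz_row_eq0 -mxrank_eq0 mxrank_ker subn_eq0 -ltnNge.
exact: leq_ltn_trans (rank_leq_col _) qm.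
Qed.

Lemma free_le_generators q m (s : 'I_q -> V) (t : 'I_m -> V) :
  generates sigma U [set 0] s -> (forall i, U (t i)) ->
  free_mod sigma [set 0] t -> (m <= q)%N.
Proof.
move=> gs Ut ft; have [c hc] := generates_family gs Ut.
rewrite leqNgt; apply/negP => qm.
have [v /negP v0 vM] := exists_left_kernel (\matrix_(i, j) c i j) qm.
case: v0; apply/eqP/rowP => i; rewrite mxE; move: i; apply: ft => /=.
have -> : comb sigma (v 0) t = comb sigma (fun j => \sum_i v 0 i * c i j) s.
  by rewrite comb_mulmx; apply: eq_bigr => i _; congr (_ *: _); apply/eqP;
    rewrite -subr_eq0; apply/eqP/hc.
apply: big1 => j _; move/rowP/(_ j): vM; rewrite !mxE.
by under eq_bigr do rewrite mxE; move=> ->; rewrite rmorph0 scale0r.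
Qed.

(** The new vector comes first because flags are built from the socle upwards: the old flag must be
    a tail of the new one. *)
Definition extend_family k (s : 'I_k -> V) (u : V) (i : 'I_k.+1) : V :=
  oapp s u (unlift ord0 i).

Lemma extend_family0 k (s : 'I_k -> V) u : extend_family s u ord0 = u.
Proof. by rewrite /extend_family unlift_none. Qed.

Lemma extend_family_lift k (s : 'I_k -> V) u i :
  extend_family s u (lift ord0 i) = s i.
Proof. by rewrite /extend_family liftK. Qed.

Lemma extend_family_free k (s : 'I_k -> V) u :
  free_mod sigma [set 0] s -> ~ (exists c, u = comb sigma c s) ->
  free_mod sigma [set 0] (extend_family s u).
Proof.
move=> fs nu c; rewrite /= /comb big_ord_recl extend_family0.
under eq_bigr do rewrite extend_family_lift.
have [c0|c0] := eqVneq (c ord0) 0; last first.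
  move=> /eqP; rewrite addr_eq0 => /eqP hu; case: nu.
  exists (fun i => - (c ord0)^-1 * c (lift ord0 i)).
  rewrite -combZ rmorphN scaleNr /comb -scalerN -hu scalerA -rmorphM mulVf //.
  by rewrite rmorph1 scale1r.
rewrite c0 rmorph0 scale0r add0r => /fs h i.
by case: (unliftP ord0 i) => [j ->|->]; first exact: h.
Qed.

Lemma maximal_free_generates k (s : 'I_k -> V) :
  (forall i, U (s i)) -> free_mod sigma [set 0] s ->
  ~ (exists t : 'I_k.+1 -> V,
       (forall i, U (t i)) /\ free_mod sigma [set 0] t) ->
  generates sigma U [set 0] s.
Proof.
move=> Us fs nt; split=> // u Uu; apply: contrapT => nu; apply: nt.
exists (extend_family s u); split=> [i|].
  by rewrite /extend_family; case: unliftP => [j _|_]; [exact: Us|exact: Uu].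
by apply: extend_family_free fs _ => -[c uc]; apply: nu; exists c;
  rewrite uc subrr.
Qed.

End FieldRank.

(** * Matrices over a local ring inside the ring of rational functions *)

Section IntegralMatrices.
Variables (P : Type) (T : comNzRingType) (O : P -> set T) (p : P).

(** Abstracted so that one calculus of lattices serves both O_p and its thickening over A, which
    carries no valuation. *)
Definition is_subring :=
  [/\ O p 1, forall x y, O p x -> O p y -> O p (x - y) &
      forall x y, O p x -> O p y -> O p (x * y)].

Hypothesis Op : is_subring.

Lemma subring0 : O p 0.
Proof. by have [O1 OB _] := Op; rewrite -(subrr 1); exact: OB. Qed.

Lemma subringD x y : O p x -> O p y -> O p (x + y).
Proof.
have [_ OB _] := Op; move=> Ox Oy; rewrite -[y]opprK -[- y]add0r.
by apply: (OB) => //; apply: (OB) => //; exact: subring0.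
Qed.

Lemma subring_sum (I : finType) (Q : pred I) (u : I -> T) :
  (forall i, Q i -> O p (u i)) -> O p (\sum_(i | Q i) u i).
Proof.
by move=> Ou; apply: (big_ind (O p)); [exact: subring0|exact: subringD|].
Qed.

Lemma subring_prod (I : finType) (Q : pred I) (u : I -> T) :
  (forall i, Q i -> O p (u i)) -> O p (\prod_(i | Q i) u i).
Proof. by have [O1 _ OM] := Op; move=> Ou; apply: (big_ind (O p)). Qed.

Lemma integral_mx1 n : integral O p (1%:M : 'M_n).
Proof.
by move=> i j; rewrite mxE; case: eqP => _; [have [] := Op|exact: subring0].
Qed.

Lemma integralD m n (A B : 'M[T]_(m, n)) :
  integral O p A -> integral O p B -> integral O p (A + B).
Proof. by move=> hA hB i j; rewrite mxE; exact: subringD. Qed.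

Lemma integral_sum m n (I : finType) (M : I -> 'M[T]_(m, n)) :
  (forall i, integral O p (M i)) -> integral O p (\sum_i M i).
Proof.
by move=> hM i j; rewrite summxE; apply: subring_sum => k _; exact: hM.
Qed.

Lemma integralB m n (A B : 'M[T]_(m, n)) :
  integral O p A -> integral O p B -> integral O p (A - B).
Proof.
by have [_ OB _] := Op; move=> hA hB i j; rewrite !mxE; exact: OB.
Qed.

Lemma integralM m n k (A : 'M[T]_(m, n)) (B : 'M[T]_(n, k)) :
  integral O p A -> integral O p B -> integral O p (A *m B).
Proof.
move=> hA hB i j; rewrite mxE; apply: subring_sum => l _.
by have [_ _ OM] := Op; exact: OM.
Qed.

Lemma integralZ m n a (A : 'M[T]_(m, n)) :
  O p a -> integral O p A -> integral O p (a *: A).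
Proof. by have [_ _ OM] := Op; move=> Oa hA i j; rewrite mxE; exact: OM. Qed.

Lemma integral_det n (A : 'M[T]_n) : integral O p A -> O p (\det A).
Proof.
have [O1 OB OM] := Op; move=> hA; apply: subring_sum => s _; apply: (OM).
  rewrite -signr_odd; case: (odd _); rewrite ?expr0 // expr1 -[-1]add0r.
  by apply: (OB) => //; exact: subring0.
by apply: subring_prod.
Qed.

Lemma integral_adj n (A : 'M[T]_n) : integral O p A -> integral O p (\adj A).
Proof.
have [O1 OB OM] := Op; move=> hA i j; rewrite mxE; apply: (OM).
  rewrite -signr_odd; case: (odd _); rewrite ?expr0 // expr1 -[-1]add0r.
  by apply: (OB) => //; exact: subring0.
by apply: integral_det => a b; rewrite !mxE.
Qed.

Lemma integral_submx m n m' n' (A : 'M[T]_(m, n)) (f : 'I_m' -> 'I_m)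
    (g : 'I_n' -> 'I_n) : integral O p A -> integral O p (mxsub f g A).
Proof. by move=> hA i j; rewrite mxE. Qed.

End IntegralMatrices.

(** * Places and weak approximation *)

Section Places.
Variables (F : fieldType) (C : curve F).
Implicit Types (p q : place C) (x y : C).

Lemma OringN p x : Oring p x -> Oring p (- x).
Proof.
move=> hx; rewrite -mulN1r -(rmorph1 (cst C)) -rmorphN.
by apply: OringM => //; rewrite /Oring /= pval_cst.
Qed.

Lemma OringD p x y : Oring p x -> Oring p y -> Oring p (x + y).
Proof.
rewrite /Oring /=; have [->|x0] := eqVneq x 0; first by rewrite add0r.
have [->|y0] := eqVneq y 0; first by rewrite addr0.
have [->|xy0] := eqVneq (x + y) 0; first by rewrite pval0.
move=> hx hy; apply: le_trans (pvalD p x0 y0 xy0).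
by rewrite le_min hx hy.
Qed.

Lemma OringB p x y : Oring p x -> Oring p y -> Oring p (x - y).
Proof. by move=> hx hy; apply: OringD => //; exact: OringN. Qed.

Lemma Oring_cst p c : Oring p (cst C c).
Proof. by rewrite /Oring /= pval_cst. Qed.

Lemma Oring1 p : Oring p 1.
Proof. by rewrite /Oring /= pval1. Qed.

Lemma Oring_sum p (I : finType) (u : I -> C) :
  (forall i, Oring p (u i)) -> Oring p (\sum_i u i).
Proof.
move=> h; apply: (big_ind (Oring p)) => // [|x y]; first exact: Oring0.
exact: OringD.
Qed.

Lemma pvalN p x : pval p (- x) = pval p x.
Proof.
have [->|x0] := eqVneq x 0; first by rewrite oppr0.
rewrite -mulN1r -(rmorph1 (cst C)) -rmorphN pvalM ?pval_cst ?add0r //.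
by rewrite rmorphN rmorph1 oppr_eq0 oner_eq0.
Qed.

Lemma pvalV p x : x != 0 -> pval p x^-1 = - pval p x.
Proof.
move=> x0; apply/eqP; rewrite -addr_eq0 -pvalM ?invr_eq0 //.
by rewrite mulVf // pval1.
Qed.

Lemma pvalX p x n : x != 0 -> pval p (x ^+ n) = n%:Z * pval p x.
Proof.
move=> x0; elim: n => [|n IH]; first by rewrite expr0 pval1 mul0r.
by rewrite exprS pvalM ?expf_neq0 // IH -[n.+1]addn1 PoszD mulrDl mul1r addrC.
Qed.

Lemma pvalXz p x (n : int) : x != 0 -> pval p (x ^ n) = n * pval p x.
Proof.
move=> x0; case: (intP n) => [|k|k]; first by rewrite expr0z pval1 mul0r.
  by rewrite -exprnP pvalX.
by rewrite -exprnN pvalV ?expf_neq0 // pvalX // mulNr.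
Qed.

(** The nonvanishing guards are there because [pval p 0] is the dummy 0 instead of infinity. *)
Lemma pval_gt_sum p (I : finType) (P : pred I) (u : I -> C) k :
  (forall i, P i -> u i != 0 -> k < pval p (u i)) ->
  \sum_(i | P i) u i != 0 -> k < pval p (\sum_(i | P i) u i).
Proof.
move=> h; apply: (big_ind (fun s => s != 0 -> k < pval p s)) => //.
  by rewrite eqxx.
move=> x y; have [->|x0] := eqVneq x 0; first by rewrite add0r.
have [->|y0] := eqVneq y 0; first by move=> /(_ isT) hx _ _; rewrite addr0.
move=> /(_ isT) hx /(_ isT) hy xy0; apply: lt_le_trans (pvalD p x0 y0 xy0).
by rewrite lt_min hx hy.
Qed.

Lemma dominant_term p (I : finType) (u : I -> C) i0 :
  u i0 != 0 ->
  (forall i, i != i0 -> u i != 0 -> pval p (u i0) < pval p (u i)) ->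
  \sum_i u i != 0.
Proof.
move=> u0 h; rewrite (bigD1 i0) //=; apply/eqP => /eqP.
rewrite addrC addr_eq0 => /eqP s; have := pval_gt_sum h.
by rewrite s oppr_eq0 u0 pvalN ltxx => /(_ isT).
Qed.

Lemma pvalD_lt p x y : x != 0 -> y != 0 -> pval p x < pval p y ->
  x + y != 0 /\ pval p (x + y) = pval p x.
Proof.
move=> x0 y0 xy; have s0 : x + y != 0.
  by rewrite addr_eq0; apply/eqP => e; move: xy; rewrite e pvalN ltxx.
split=> //; have := pvalD p x0 y0 s0; rewrite minEle (ltW xy) => h.
apply/eqP; rewrite eq_le h andbT leNgt; apply/negP => hs.
have := @pvalD _ _ p (x + y) (- y) s0; rewrite oppr_eq0 addrK pvalN.
move=> /(_ y0 x0); rewrite leNgt lt_min hs xy; discriminate.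
Qed.

Lemma place_ext p q : (forall x, pval p x = pval q x) -> p = q.
Proof.
case: p q => f a b c d e [f' a' b' c' d' e'] /= /funext ff'; subst f'.
by congr Place; exact: Prop_irrelevance.
Qed.

(** Otherwise the ring of [p] lies in that of [q], units at [p] are units at [q], and [pval q] is
    [pval p] times its value at a uniformizer [t] of [p]. Surjectivity of [pval q] makes this value
    1, so the places agree. *)
Lemma place_neq_half p q : p <> q ->
  exists u, [/\ u != 0, 0 <= pval p u & pval q u < 0].
Proof.
move=> npq; apply: contrapT => h; apply: npq.
have hge u : u != 0 -> 0 <= pval p u -> 0 <= pval q u.
  by move=> u0 pu; rewrite leNgt; apply/negP => qu; apply: h; exists u.
have h0 u : u != 0 -> pval p u = 0 -> pval q u = 0.
  move=> u0 pu; apply/eqP; rewrite eq_le hge ?pu // andbT.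
  by rewrite -oppr_ge0 -pvalV // hge ?invr_eq0 // pvalV // pu.
have [t pt] := pval_onto p; have t0 : t != 0.
  by apply/eqP => t0; move: pt; rewrite t0 pval0.
have hq x : x != 0 -> pval q x = pval p x * pval q t.
  move=> x0; have := h0 (x * t ^ (- pval p x)).
  rewrite mulf_neq0 ?expfz_neq0 // !pvalM ?expfz_neq0 // !pvalXz // pt.
  by rewrite mulr1 subrr mulNr => /(_ isT erefl) /eqP; rewrite subr_eq0 => /eqP.
have qt : 0 <= pval q t by rewrite hge // pt.
have [t' qt'] := pval_onto q; have t'0 : t' != 0.
  by apply/eqP => t'0; move: qt'; rewrite t'0 pval0.
have qt1 : pval q t = 1.
  have := hq _ t'0; rewrite qt' => e; have : (pval p t' * pval q t = 1) by [].
  move: qt; clear; move: (pval p t') (pval q t) => a b b0 ab.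
  by have [a0|a0] := lerP a 0; nia.
apply: place_ext => x; have [->|x0] := eqVneq x 0; first by rewrite !pval0.
by rewrite (hq x x0) qt1 mulr1.
Qed.

Lemma place_neq p q : p <> q ->
  exists z, [/\ z != 0, pval p z < 0 & 0 < pval q z].
Proof.
move=> npq; have [u [u0 pu qu]] := place_neq_half npq.
have [w [w0 qw pw]] := place_neq_half (nesym npq).
exists (w / u); rewrite mulf_neq0 ?invr_eq0 // !pvalM ?invr_eq0 // !pvalV //.
by split=> //; lia.
Qed.

Lemma weak_approximation p (s : seq (place C)) :
  p \notin s -> exists z, [/\ z != 0, pval p z < 0 &
    forall q, q \in s -> 0 < pval q z].
Proof.
elim: s => [_|q s IH].
  have [t pt] := pval_onto p; have t0 : t != 0.
    by apply/eqP => t0; move: pt; rewrite t0 pval0.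
  by exists t^-1; rewrite invr_eq0 pvalV // pt.
rewrite inE negb_or => /andP[/eqP/place_neq [w [w0 pw qw]] /IH [y [y0 py sy]]].
(* Large enough for the zeros of [y ^+ N] to outweigh the poles of [w] at every place of [s]. *)
pose N := (\sum_(r <- s) `|pval r w|).+1%N.
have hN r : r \in s -> 0 < pval r w + N%:Z * pval r y.
  move=> rs; have yr := sy r rs.
  have : (`|pval r w| < N)%N by rewrite ltnS (big_rem r) //= leq_addr.
  by nia.
have yN : y ^+ N != 0 by rewrite expf_neq0.
case: (ltrgtP (pval q y) 0) => qy.
(* If [y] has a pole at [q], the factor [y ^+ N / (y ^+ N + 1)] is a unit at [p] and at [q], and
   vanishes like [y ^+ N] on [s]. *)
- have [] // := @pvalD_lt p (y ^+ N) 1; rewrite ?oner_eq0 ?pval1 ?pvalX //.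
    by nia.
  move=> n1 vp; have [] // := @pvalD_lt q (y ^+ N) 1;
    rewrite ?oner_eq0 ?pval1 ?pvalX //.
    by nia.
  move=> _ vq.
  exists (w * y ^+ N / (y ^+ N + 1)); rewrite !mulf_neq0 ?invr_eq0 //;
    split=> //.
    rewrite !pvalM ?mulf_neq0 ?invr_eq0 // pvalV // pvalX //.
    by rewrite vp; lia.
  move=> r; rewrite inE => /orP[/eqP ->|rs].
    rewrite !pvalM ?mulf_neq0 ?invr_eq0 // pvalV // pvalX //.
    by rewrite vq; lia.
  have v1 : pval r (1 + y ^+ N) = pval r 1.
    by apply: (proj2 (pvalD_lt _ _ _));
      rewrite ?oner_eq0 ?pval1 ?pvalX ?mulr_gt0 ?sy.
  rewrite !pvalM ?mulf_neq0 ?invr_eq0 // pvalV // pvalX //.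
  by have := hN r rs; rewrite [y ^+ N + 1]addrC v1 pval1; lia.
- exists y; split=> // r; rewrite inE => /orP[/eqP -> //|]; exact: sy.
exists (w * y ^+ N); rewrite mulf_neq0 // !pvalM // !pvalX //; split=> //.
  by nia.
move=> r; rewrite inE pvalM // pvalX // => /orP[/eqP ->|/hN //].
by rewrite qy mulr0 addr0.
Qed.

Lemma exists_dependency (I J : finType) (M : I -> J -> F) : (#|J| < #|I|)%N ->
  exists2 v : I -> F, (exists i, v i != 0) & forall j, \sum_i v i * M i j = 0.
Proof.
move=> JI.
have [v /rV0Pn [i vi] vM] :=
  exists_left_kernel (\matrix_(i, j) M (enum_val i) (enum_val j)) JI.
exists (fun i => v 0 (enum_rank i)); first by exists (enum_val i);
  rewrite enum_valK.
move=> j; move/rowP/(_ (enum_rank j)): vM; rewrite !mxE => h; rewrite -[RHS]h.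
rewrite (reindex_onto (@enum_val I predT) enum_rank) => [|k _];
  last by rewrite enum_rankK.
apply: eq_big => [k|k _]; first by rewrite enum_valK eqxx.
by rewrite mxE enum_valK enum_rankK.
Qed.

(** * Finiteness of the zeros of a rational function *)

Section Zeros.
Variables (f : C).
Hypothesis f0 : f != 0.

(** Among the terms with nonzero coefficient take one, [(i, l)], with least power [l] of [f]. At
    [P i] its valuation is strictly the smallest: [z j] has a zero there for [j != i], and a higher
    power of [f] raises the valuation. *)
Lemma zeros_independent r (P : 'I_r -> place C) (z : 'I_r -> C) N
    (c : 'I_r * 'I_N -> F) :
  (forall i, 0 < pval (P i) f) -> (forall i, z i != 0) ->
  (forall i, pval (P i) (z i) < 0) ->
  (forall i j, i != j -> 0 < pval (P i) (z j)) ->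
  \sum_k cst C (c k) * (f ^+ k.2 * z k.1) = 0 -> forall k, c k = 0.
Proof.
move=> Pf z0 zi zj + k0; apply: contra_eq => ck0.
case: (@arg_minnP _ k0 (fun k => c k != 0) (fun k => k.2 : nat) ck0) =>
  [[i l] /= cil min].
have t0 (k : 'I_r * 'I_N) : f ^+ k.2 * z k.1 != 0 by rewrite mulf_neq0
  ?expf_neq0.
have c0 k : c k != 0 -> cst C (c k) != 0 by rewrite fmorph_eq0.
apply: (@dominant_term (P i) _ _ (i, l)); first by rewrite mulf_neq0 ?c0.
move=> [j k] jk; have [->|cjk _] := eqVneq (c (j, k)) 0.
  by rewrite rmorph0 mul0r eqxx.
rewrite !pvalM ?c0 ?t0 ?expf_neq0 //= !pval_cst !pvalX // !add0r.
have lk : (l <= k)%N by apply: (min (j, k)).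
have Pfi := Pf i; have zii := zi i.
have [ij|ij] := eqVneq j i; last first.
  by have := zj i j; rewrite eq_sym => /(_ ij) ?; nia.
rewrite ij ltrD2r ltr_pM2r // ltz_nat ltn_neqAle lk andbT.
by apply: contraNneq jk => /val_inj ->; rewrite ij.
Qed.

End Zeros.

Section Counting.
Variables (x : C) (m : nat) (b : 'I_m -> C).
Hypothesis x_transc : forall p : {poly F}, p != 0 ->
  (map_poly (cst C) p).[x] != 0.
Hypothesis b_gen : forall z : C, exists (q : {poly F}) (p : 'I_m -> {poly F}),
  q != 0 /\ z * (map_poly (cst C) q).[x] =
            \sum_(i < m) (map_poly (cst C) (p i)).[x] * b i.

Let ev : {rmorphism {poly F} -> C} := horner_eval x \o map_poly (cst C).

Let evC c : ev c%:P = cst C c.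
Proof. by rewrite /ev /= /horner_eval map_polyC hornerC. Qed.

Lemma common_denominator r (u : 'I_r -> C) :
  exists (q : {poly F}) (B : 'I_r -> 'I_m -> {poly F}),
    q != 0 /\ forall j, u j * ev q = \sum_k ev (B j k) * b k.
Proof.
have /choice [q /choice [B hB]] j := b_gen (u j).
exists (\prod_j q j), (fun j k => (\prod_(i | i != j) q i) * B j k); split.
  by apply/prodf_neq0 => j _; have [] := hB j.
move=> j; rewrite (bigD1 j) // rmorphM mulrA; have [_ e] := hB j.
rewrite [X in X * _]e mulr_suml; apply: eq_bigr => k _.
by rewrite rmorphM mulrC mulrA.
Qed.

Lemma power_coordinates (f : C) : exists (q : {poly F}) (e : nat),
  [/\ q != 0, (size q <= e)%N & forall r (z : 'I_r -> C),
    exists (q0 : {poly F}) (c : nat), q0 != 0 /\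
    forall N, exists B : 'I_r -> 'I_m -> {poly F},
      (forall j k, (size (B j k) <= c + e * N)%N) /\
      forall j, f ^+ N * z j * ev (q0 * q ^+ N) = \sum_k ev (B j k) * b k].
Proof.
have [q [A [q_0 hA]]] := common_denominator (fun k => f * b k).
exists q, (maxn (size q) (\max_j \max_k size (A j k))); split=> //.
  exact: leq_maxl.
move=> r z; have [q0 [B [q00 hB]]] := common_denominator z.
exists q0, (\max_j \max_k size (B j k)); split=> //.
set c := \max_j _; set e := maxn _ _.
elim=> [|N [B' [sB' hB']]].
  exists B; split=> [j k|j]; last by rewrite !expr0 mul1r mulr1.
  rewrite muln0 addn0; apply: leq_trans (leq_bigmax j).
  exact: (leq_bigmax (F := fun k => size (B j k)) k).
exists (fun j k => \sum_l B' j l * A l k); split=> [j k|j].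
  apply: leq_trans (size_sum _ _ _) _; apply/bigmax_leqP => l _.
  apply: leq_trans (size_polyMleq _ _) _.
  apply: leq_trans (leq_pred _) _; rewrite mulnS addnCA addnC leq_add //.
  apply: leq_trans (leq_maxr _ _); apply: leq_trans (leq_bigmax l).
  exact: (leq_bigmax (F := fun k => size (A l k)) k).
have -> : f ^+ N.+1 * z j * ev (q0 * q ^+ N.+1) =
  f * ev q * (f ^+ N * z j * ev (q0 * q ^+ N)).
  by rewrite !exprS !rmorphM; ring.
rewrite hB' mulr_sumr; under eq_bigr => l _.
  have -> : f * ev q * (ev (B' j l) * b l) =
    ev (B' j l) * (f * b l * ev q) by ring.
  rewrite hA mulr_sumr; over.
rewrite exchange_big; apply: eq_bigr => k _; rewrite rmorph_sum mulr_suml.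
by apply: eq_bigr => l _; rewrite rmorphM mulrA.
Qed.

(* The [r * N] elements [f ^+ i * z j] lie, up to the common denominator
   [q0 * q ^+ N], in a space of dimension [m * (c + e * N)], and [e] does not
   depend on [r]. *)
Lemma bounded_independence (f : C) : exists r, forall z : 'I_r -> C,
  exists N (c : 'I_r * 'I_N -> F), (exists k, c k != 0) /\
    \sum_k cst C (c k) * (f ^+ k.2 * z k.1) = 0.
Proof.
have [q [e [q_0 qe hq]]] := power_coordinates f.
exists (m * e).+1 => z; have [q0 [c [q00 /choice [B hB]]]] := hq _ z.
(* With [r = m * e + 1], the inequality [m * (c + e * N) < r * N] reduces to [m * c < N]. *)
pose N := (m * c).+1; pose D := (c + e * N)%N.
pose M (k : 'I_(m * e).+1 * 'I_N) (l : 'I_m * 'I_D) :=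
  (q ^+ (N - k.2) * B k.2 k.1 l.1)`_(l.2).
have [|v v0 hv] := exists_dependency M.
  by rewrite !card_prod !card_ord /D /N; nia.
exists N, v; split=> //; apply/eqP.
have den0 : ev (q0 * q ^+ N) != 0 by apply: x_transc;
  rewrite mulf_neq0 ?expf_neq0.
rewrite -(inj_eq (mulIf den0)) mul0r mulr_suml; apply/eqP.
have term (k : 'I_(m * e).+1 * 'I_N) :
    cst C (v k) * (f ^+ k.2 * z k.1) * ev (q0 * q ^+ N) =
    \sum_l ev (v k *: (q ^+ (N - k.2) * B k.2 k.1 l)) * b l.
  have [_ /(_ k.1) h] := hB k.2.
  have -> : q0 * q ^+ N = q0 * q ^+ k.2 * q ^+ (N - k.2).
    by rewrite -mulrA -exprD subnKC // ltnW.
  rewrite rmorphM.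
  rewrite mulrA -(mulrA (cst C _)) h -mulrA mulr_suml mulr_sumr.
  apply: eq_bigr => l _; rewrite -mul_polyC !rmorphM evC; ring.
under eq_bigr do rewrite term.
rewrite exchange_big big1 // => l _; rewrite -mulr_suml -rmorph_sum.
suff -> : \sum_k v k *: (q ^+ (N - k.2) * B k.2 k.1 l) =
  0 by rewrite rmorph0 mul0r.
apply/polyP => i; rewrite coef0 coef_sum; under eq_bigr do rewrite coefZ.
have [iD|iD] := ltnP i D; first by rewrite -[RHS](hv (l, Ordinal iD)).
apply: big1 => k _; rewrite nth_default ?mulr0 //; apply: leq_trans iD.
apply: leq_trans (size_polyMleq _ _) _.
have [/(_ k.1 l) sB _] := hB k.2; have := ltn_ord k.2.
have : (size (q ^+ (N - k.2)) <= (e * (N - k.2)).+1)%N.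
  apply: leq_trans (size_poly_exp_leq _ _) _; rewrite ltnS leq_mul2r.
  by rewrite (leq_trans (leq_pred _) qe) orbT.
rewrite /D; move: (size _) (size _) sB => s1 s2.
rewrite mulnBr => sB s1e /ltnW kN;
  have : (e * k.2 <= e * N)%N by rewrite leq_mul2l kN orbT.
move: (e * k.2)%N (e * N)%N sB s1e => a a' *; lia.
Qed.

End Counting.

(** Infinitely many zeros would give, by weak approximation, any number of functions [z i] with the
    [f ^+ l * z i] independent, against [bounded_independence]. *)
Lemma finite_zeros (f : C) : f != 0 ->
  finite_set [set p : place C | 0 < pval p f].
Proof.
move=> f0; apply: contrapT => infZ.
have [x [x_transc [m [b b_gen]]]] := curveP C.
have [r hr] := bounded_independence x_transc b_gen f.
(* One zero beyond [r], so that [nth] has a default value even for [r = 0]. *)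
have [Z Zf rs] := infinite_set_fset r.+1 infZ.
have [p0 _] : exists p0, p0 \in finmap.enum_fset Z.
  by case: (finmap.enum_fset Z) rs => // p0 s _; exists p0; rewrite mem_head.
pose Q (i : 'I_r) := nth p0 (finmap.enum_fset Z) i.
have ltQ (i : 'I_r) : (i < size (finmap.enum_fset Z))%N by apply: ltn_trans rs.
have Qf i : 0 < pval (Q i) f by apply/Zf/mem_nth/ltQ.
have Qinj : injective Q.
  by move=> i j /eqP; rewrite nth_uniq ?finmap.fset_uniq // => /eqP/val_inj.
have /choice [z hz] (i : 'I_r) : exists z, [/\ z != 0, pval (Q i) z < 0 &
    forall j, j != i -> 0 < pval (Q j) z].
  have [|z [z0 zi zj]] := @weak_approximation (Q i) [seq Q j | j <- enum 'I_r
    & j != i].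
    apply/mapP => -[j]; rewrite mem_filter => /andP[+ _] /Qinj e.
    by rewrite e eqxx.
  exists z; split=> // j ji; apply: zj; apply/mapP; exists j => //.
  by rewrite mem_filter ji mem_enum.
have [N [c [[k ck] sum0]]] := hr z.
move/negP: ck; apply; apply/eqP; move: k.
apply: (zeros_independent f0 Qf) sum0 => [i|i|i j ij]; have [//] := hz i.
by have [_ _ ->] := hz j.
Qed.

End Places.

(** * Saturation of a section *)

Section Elimination.
Variables (K : fieldType) (n : nat).
Implicit Types (w : 'rV[K]_n.+1) (j : 'I_n.+1).

(* The quotient map of [K^(n+1)] by the line of [w], in the coordinates other
   than [j], through which the quotient is identified with [K^n]. *)
Definition elim_mx w j : 'M[K]_(n.+1, n) :=
  colsub (lift j) (1%:M - (w 0 j)^-1 *: (delta_mx j 0 *m w)).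

Lemma delta_mulE w j i k : (delta_mx j 0 *m w) i k = (i == j)%:R * w 0 k.
Proof. by rewrite mxE big_ord1 mxE eqxx andbT. Qed.

Lemma mul_row_delta w j : w *m delta_mx j 0 = (w 0 j)%:M :> 'M_1.
Proof.
apply/matrixP => a b; rewrite !ord1 !mxE eqxx (bigD1 j) //= mxE !eqxx mulr1.
by rewrite big1 ?addr0 // => k /negPf kj; rewrite mxE kj mulr0.
Qed.

Lemma mul_elim_mx w j : w 0 j != 0 -> w *m elim_mx w j = 0.
Proof.
move=> wj; rewrite mulmx_colsub mulmxBr mulmx1 -scalemxAr mulmxA.
rewrite mul_row_delta mul_scalar_mx scalerA mulVf // scale1r subrr.
by apply/matrixP => a b; rewrite !mxE.
Qed.

Lemma section_elim_mx w j : rowsub (lift j) 1%:M *m elim_mx w j = 1%:M.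
Proof.
rewrite mul_rowsub_mx mul1mx; apply/matrixP => a b; rewrite mxE mxE mxE.
rewrite !mxE (inj_eq lift_inj) big_ord1 mxE.
by rewrite [lift j a == j]eq_sym (negPf (neq_lift _ _)) mul0r mulr0 subr0.
Qed.

(** The right side is the projector along [w] onto the hyperplane where the [j]-th coordinate
    vanishes. *)
Lemma elim_mx_section w j : w 0 j != 0 ->
  elim_mx w j *m rowsub (lift j) 1%:M =
    1%:M - (w 0 j)^-1 *: (delta_mx j 0 *m w).
Proof.
move=> wj; set N := 1%:M - _; rewrite -[RHS]mulmx1.
apply/matrixP => a b; rewrite [LHS]mxE [RHS]mxE (bigD1_ord j) //=.
have -> : N a j = 0.
  by rewrite /N mxE mxE mxE [in X in _ -
    X]mxE delta_mulE mulrCA mulVf // mulr1 subrr.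
rewrite mul0r add0r; apply: eq_bigr => k _; congr (_ * _); by rewrite !mxE.
Qed.

End Elimination.

Section FirstType.
Variables (F : fieldType) (C : curve F).

Lemma Oring_subring p : is_subring (@Oring F C) p.
Proof.
by split; [exact: Oring1|move=> x y; exact: OringB|move=> x y; exact: OringM].
Qed.

Lemma exists_min_val (p : place C) n (v : 'rV[C]_n) : v != 0 ->
  exists2 j, v 0 j != 0 & forall k, Oring p (v 0 k / v 0 j).
Proof.
move=> /rV0Pn [j0 vj0].
case: (@Order.TotalTheory.arg_minP _ _ _ j0 (fun j => v 0 j != 0) (fun j =>
  pval p (v 0 j)) vj0).
move=> j vj hj; exists j => // k.
have [->|vk] := eqVneq (v 0 k) 0; first by rewrite mul0r; exact: Oring0.
by rewrite /Oring /= pvalM ?invr_eq0 // pvalV // subr_ge0 hj.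
Qed.

Section Saturation.
Variables (n : nat) (E : vbundle C n.+1) (s : 'rV[C]_n.+1).
Hypotheses (s0 : s != 0) (Es : H0 E s).

Let V p := s *m cofr E p.

Let sE p : s = V p *m fr E p.
Proof. by rewrite -mulmxA (mulmx1C (fr_cofr E p)) mulmx1. Qed.

Let V0 p : V p != 0.
Proof. by apply: contra_neq s0 => V0; rewrite (sE p) V0 mul0mx. Qed.

Let exj p : exists j, V p 0 j != 0 /\ forall k, Oring p (V p 0 k / V p 0 j).
Proof. by have [j ? ?] := exists_min_val p (V0 p); exists j. Qed.

Let j p := sval (cid (exj p)).
Let Vj p : V p 0 (j p) != 0.
Proof. by rewrite /j; case: cid => ? []. Qed.
Let Vmin p k : Oring p (V p 0 k / V p 0 (j p)).
Proof. by rewrite /j; case: cid => ? []. Qed.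

Let exj0 : exists j0, s 0 j0 != 0.
Proof. exact/rV0Pn. Qed.
Let j0 := sval (cid exj0).
Let sj0 : s 0 j0 != 0.
Proof. by rewrite /j0; case: cid. Qed.

(** The order of vanishing of [s] at [p]: [j p] indexes a local coordinate of least valuation. *)
Let d p := pval p (V p 0 (j p)).

Let good p := integral (@Oring F C) p (fr E p) /\ integral (@Oring F C) p
  (cofr E p).

(** Where the frames of [E] are integral, a positive order of vanishing makes the fixed nonzero
    coordinate [s 0 j0] vanish, and this function has finitely many zeros. *)
Lemma section_divisor_fin : finite_set [set p | d p != 0].
Proof.
apply: (@sub_finite_set _ _ ([set p | ~ good p] `|` [set p | 0 < pval p (s 0
  j0)])).
  2: by rewrite finite_setU; split; [exact: bundle_ae|exact: finite_zeros].
move=> p /= dp; apply: contrapT => /not_orP [/contrapT [gf gc]]; apply.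
have d_gt0 : 0 < d p by rewrite lt_neqAle eq_sym dp /=; exact: (Es p 0 (j p)).
rewrite (sE p) mxE; apply: pval_gt_sum; last by have := sj0; rewrite (sE p) mxE.
move=> k _; rewrite mulf_eq0 negb_or => /andP[Vk frk]; rewrite pvalM //.
have := gf k j0; have := Vmin p k;
  rewrite /Oring /= pvalM ?invr_eq0 // pvalV //.
by rewrite -/(d p); lia.
Qed.

Definition section_divisor := Divisor section_divisor_fin.

Lemma section_divisor_effective : effective section_divisor.
Proof. by move=> p; exact: (Es p 0 (j p)). Qed.

Lemma unif_pow_val (p : place C) k : pval p (unif p ^ k) = k.
Proof.
rewrite pvalXz ?unif_neq0 // /unif; case: cid => t /= ->; exact: mulr1.
Qed.

(** All coordinates of [V p] are integral multiples of the one at [j p], so integrality of [x *m s]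
    is decided there, where the valuation is that of [x] plus [d p]. The equivalence is what makes
    the subsheaf saturated. *)
Lemma stalk_section_divisor p (x : 'rV[C]_1) :
  stalk (OD section_divisor) p x <-> stalk E p (x *m s).
Proof.
have u0 : unif p ^ d p != 0 by rewrite expfz_neq0 ?unif_neq0.
have -> : stalk (OD section_divisor) p x <-> Oring p (x 0 0 * V p 0 (j p)).
  rewrite /stalk /= mul_mx_scalar.
  have e : Oring p (x 0 0 * unif p ^ d p) <-> Oring p (x 0 0 * V p 0 (j p)).
    have [->|x0] := eqVneq (x 0 0) 0; first by rewrite !mul0r.
    by rewrite /Oring /= !pvalM // unif_pow_val.
  split=> [/(_ 0 0)|h a b]; first by rewrite mxE mulrC e.
  by rewrite !ord1 mxE mulrC e.
have e : x *m s *m cofr E p = x 0 0 *: V p.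
  by rewrite -mulmxA [x]mx11_scalar mul_scalar_mx mxE eqxx.
rewrite /stalk /= e; split=> [h a k|/(_ 0 (j p))]; last by rewrite mxE.
rewrite !ord1 mxE -[V p 0 k](divfK (Vj p)) mulrCA.
by apply: OringM => //; exact: Vmin.
Qed.

(** The quotient has one generic coordinate system, omitting [j0], but its basis at [p] omits the
    index [j p], for which the elimination is integral. *)
Let Q := elim_mx s j0.
Let frQ p := rowsub (lift (j p)) (fr E p) *m Q.
Let cofrQ p := rowsub (lift j0) (cofr E p) *m elim_mx (V p) (j p).

(** Passing through the coordinates other than [j0] changes a vector by a multiple of [s], which
    becomes a multiple of [V p] and is eliminated. *)
Let Q_cofr p : Q *m cofrQ p = cofr E p *m elim_mx (V p) (j p).
Proof.
rewrite /cofrQ -[cofr E p in LHS]mul1mx -mul_rowsub_mx !mulmxA elim_mx_section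
  //.
rewrite mulmxBl mul1mx mulmxBl -!scalemxAl -!mulmxA.
by rewrite (mulmxA s) -/(V p) (mul_elim_mx (Vj p)) mulmx0 scaler0 subr0.
Qed.

Let frQ_cofrQ p : frQ p *m cofrQ p = 1%:M.
Proof.
rewrite /frQ -mulmxA Q_cofr mulmxA mul_rowsub_mx fr_cofr.
exact: section_elim_mx.
Qed.

Lemma integral_elim (p : place C) m (w : 'rV[C]_m.+1) k :
  (forall i, Oring p (w 0 i / w 0 k)) -> integral (@Oring F C) p (elim_mx w k).
Proof.
move=> h a b; rewrite !mxE big_ord1 mxE andbT.
apply: OringB; first by case: eqP => _; [exact: Oring1|exact: Oring0].
rewrite mulrCA; apply: OringM; last by rewrite mulrC.
by case: eqP => _; [exact: Oring1|exact: Oring0].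
Qed.

Let quot_ae : finite_set [set p | ~ (integral (@Oring F C) p (frQ p) /\
                                     integral (@Oring F C) p (cofrQ p))].
Proof.
apply: (@sub_finite_set _ _ ([set p | ~ good p] `|` [set p | 0 < pval p (s 0
  j0)])).
  2: by rewrite finite_setU; split; [exact: bundle_ae|exact: finite_zeros].
move=> p /= h; apply: contrapT => /not_orP [/contrapT [gf gc]] /negP;
  rewrite -leNgt => sj.
apply: h; split; apply: integralM; try exact: Oring_subring.
- exact: integral_submx.
- apply: integral_elim => i; apply: OringM; last first.
    by rewrite /Oring /= pvalV // oppr_ge0.
  suff : integral (@Oring F C) p s by [].
  by rewrite (sE p); apply: (integralM (Oring_subring p) _ gf); exact: Es.
- exact: integral_submx.
exact: integral_elim.
Qed.

Let EQ : vbundle C n := Bundle frQ_cofrQ quot_ae.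

Lemma saturation_exact : short_exact (OD section_divisor) E EQ s Q.
Proof.
move=> p; have sp := Oring_subring p; split.
- by move=> x /stalk_section_divisor.
- move=> y Ey; rewrite /stalk /= -mulmxA Q_cofr mulmxA.
  by apply: integralM => //; exact: integral_elim.
- move=> x _ /eqP; rewrite [x]mx11_scalar mul_scalar_mx scaler_eq0 (negPf s0)
  orbF.
  by move=> /eqP ->; rewrite -scalemx1 scale0r.
- move=> y Ey; split=> [yQ|[x _ ->]]; last first.
    by rewrite -mulmxA mul_elim_mx // mulmx0.
  have e : y = ((s 0 j0)^-1 * y 0 j0)%:M *m s.
    have := congr1 (mulmx^~ (rowsub (lift j0) 1%:M)) yQ.
    rewrite -mulmxA elim_mx_section // mul0mx mulmxBr mulmx1 -scalemxAr mulmxA.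
    by rewrite mul_row_delta !mul_scalar_mx scalerA => /eqP;
      rewrite subr_eq0 => /eqP.
  exists ((s 0 j0)^-1 * y 0 j0)%:M => //.
  by apply/stalk_section_divisor; rewrite -e.
move=> z Ez; exists (z *m cofrQ p *m rowsub (lift (j p)) (fr E p)).
  rewrite /stalk /= -mulmxA mul_rowsub_mx fr_cofr; apply: integralM => //.
  by apply: integral_submx; exact: (integral_mx1 sp).
rewrite -mulmxA -/(frQ p) -mulmxA (mulmx1C (frQ_cofrQ p)) mulmx1; done.
Qed.

(** All sections of [E] are rational multiples of [s], so [u |-> u *m s] identifies the sections of
    the saturation with those of [E]. *)
Lemma first_type_of_proportional k (t : 'I_k -> 'rV[C]_n.+1) (x : 'I_k -> C) :
  (0 < k)%N -> generates (cst C) (H0 E) [set 0] t ->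
    free_mod (cst C) [set 0] t ->
  (forall i, t i = x i *: s) -> first_type E.
Proof.
move=> k0 gt ft tx; exists k; split=> //; first by exists t.
exists section_divisor, EQ, s, Q; split.
- exact: section_divisor_effective.
- have H0s (u : 'rV_1) : H0 (OD section_divisor) u <-> H0 E (u *m s).
    by split=> h p; apply/stalk_section_divisor/h.
  have comb_s c : comb (cst C) c (fun i =>
    (x i)%:M : 'rV_1) *m s = comb (cst C) c t.
    rewrite mulmx_suml; apply: eq_bigr => i _.
    by rewrite -scalemxAl mul_scalar_mx -tx.
  have inj_s (u : 'rV_1) : u *m s = 0 -> u = 0.
    move/eqP; rewrite [u]mx11_scalar mul_scalar_mx scaler_eq0 (negPf s0) orbF.
    by move=> /eqP ->; rewrite -scalemx1 scale0r.
  exists (fun i => (x i)%:M); split; last first.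
    by move=> c /= h; apply: ft; rewrite /= -comb_s h mul0mx.
  split=> [i|u /H0s Eu].
    by apply/H0s; rewrite mul_scalar_mx -tx; have [] := gt.
  have [_ /(_ _ Eu) [c /= hc]] := gt; exists c; apply: inj_s.
  by rewrite mulmxBl comb_s.
exact: saturation_exact.
Qed.

End Saturation.

Lemma second_type_row_free n (E : vbundle C n) (t : 'I_2 -> 'rV[C]_n) :
  (0 < n)%N -> generates (cst C) (H0 E) [set 0] t ->
    free_mod (cst C) [set 0] t ->
  ~ first_type E -> row_free (\matrix_i t i).
Proof.
case: n E t => // n E t _ gt ft nE; apply: contra_notT nE => nfree.
have t0 : t 0 != 0.
  apply/eqP => t0.
  have /(_ (fun i => (0 == i)%:R)) := ft; rewrite comb_delta => /(_ t0 0) /eqP.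
  by rewrite eqxx oner_eq0.
have [v v0 vt] : exists2 v : 'rV_2, v != 0 & v *m \matrix_i t i = 0.
  exists (nz_row (kermx (\matrix_i t i))); last by apply/sub_kermxP;
    exact: nz_row_sub.
  by rewrite nz_row_eq0 kermx_eq0.
have {}vt : v 0 0 *: t 0 + v 0 1 *: t 1 = 0.
  by rewrite -[RHS]vt mulmx_sum_row big_ord_recl big_ord1 !rowK;
    congr (_ + _ *: t _); try congr (v _ _); apply: val_inj.
have v1 : v 0 1 != 0.
  apply: contra_neq v0 => v1; move: vt; rewrite v1 scale0r addr0 => /eqP.
  rewrite scaler_eq0 (negPf t0) orbF => /eqP v00; apply/rowP => i; rewrite mxE.
  by case: i => -[|[|//]] i; [rewrite -[RHS]v00|rewrite -[RHS]v1];
    congr (v _ _); apply: val_inj.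
pose x (i : 'I_2) := if i == 0 then 1 else - (v 0 1)^-1 * v 0 0.
apply: (@first_type_of_proportional n E (t 0) t0 _ 2 t x) => //;
  first by have [] := gt.
move=> i; rewrite /x; case: eqP => [->|i0]; first by rewrite scale1r.
have -> : i = 1 by apply: val_inj; case: i i0 => -[|[|//]] i // [];
  apply: val_inj.
rewrite mulNr scaleNr -scalerA; have := congr1 ( *:%R (v 0 1)^-1) vt.
rewrite scalerDr !scalerA mulVf // scale1r scaler0 => /eqP.
by rewrite addr_eq0 => /eqP ->; rewrite opprK.
Qed.

End FirstType.

(** * Injectivity of the Petri map *)

Section Petri.
Variables (F : fieldType) (C : curve F) (KC : vbundle C 1) (n : nat) (E :
  vbundle C n).
Variables (k : nat) (t : 'I_k -> 'rV[C]_n).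
Hypotheses (gt : generates (cst C) (H0 E) [set 0] t).
Hypothesis t_free : row_free (\matrix_i t i).

(** The coordinates of [s] on [t] form a matrix over [F] of full rank, and rank is unchanged over
    the function field. *)
Lemma sections_row_free a (s : 'I_a -> 'rV[C]_n) :
  (forall i, H0 E (s i)) -> free_mod (cst C) [set 0] s ->
  row_free (\matrix_i s i).
Proof.
move=> Es fs; have [c /= hc] := generates_family gt Es.
pose c' : 'M[F]_(a, k) := \matrix_(i, j) c i j.
have sc i : s i = comb (cst C) (c i) t by apply/eqP; rewrite -subr_eq0;
  apply/eqP.
have e : \matrix_i s i = map_mx (cst C) c' *m \matrix_i t i.
  apply/row_matrixP => i; rewrite row_mul rowK sc mulmx_sum_row.
  by apply: eq_bigr => j _; rewrite rowK !mxE.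
have fc' : row_free c'.
  apply/inj_row_free => v vc; apply/rowP => i; rewrite mxE; move: i;
    apply: fs => /=.
  rewrite /comb; under eq_bigr do rewrite sc.
  rewrite -comb_mulmx; apply: big1 => j _; move/rowP/(_ j): vc; rewrite !mxE.
  by under eq_bigr do rewrite mxE; move=> ->; rewrite rmorph0 scale0r.
rewrite /row_free e mxrankMfree // mxrank_map; exact: fc'.
Qed.

Lemma petri_injective_of_row_free : petri_injective KC E.
Proof.
move=> a b s u Es fs _ fu c c' /eqP; rewrite -subr_eq0 => /eqP e.
apply/eqP; rewrite -subr_eq0; apply/eqP.
(* Row [i] collects what is tensored with [s i]; the relation becomes a matrix product with the
   transpose of the [s i]. *)
pose w : 'M[C]_(a, 1 * n) := \matrix_i \sum_j cst C ((c - c') i j) *: u j.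
have {}e : (\matrix_i s i)^T *m w = 0.
  apply/matrixP => k1 l; rewrite [LHS]mxE [RHS]mxE.
  have /rowP/(_ (mxtens_index (k1, l))) := e; rewrite [in RHS]mxE => h;
    rewrite -[RHS]h.
  rewrite /petri -sumrB summxE; apply: eq_bigr => i _.
  rewrite -sumrB !mxE !summxE mulr_sumr; apply: eq_bigr => j _.
  rewrite -scalerBl -rmorphB [in RHS]mxE mxE.
  have -> : (s i *t u j) 0 (mxtens_index (k1, l)) = s i 0 k1 * u j 0 l.
    rewrite -tensmxE; congr (_ _ _); exact: val_inj.
  by rewrite !mxE mulrCA.
have w0 : w = 0.
  have [B hB] := row_freeP (sections_row_free Es fs).
  by rewrite -[w]mul1mx -trmx1 -hB trmx_mul -mulmxA e mulmx0.
apply/matrixP => i j; rewrite [RHS]mxE; move: j.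
apply: (fu (fun j => (c - c') i j)) => /=.
by have := congr1 (row i) w0; rewrite rowK row0.
Qed.

End Petri.

(** * Local Artinian algebras and their thickenings *)

Section FlagBasis.
Variables (F : fieldType) (C : curve F) (X : thickening C).
Local Notation A := (th_base X).
Local Notation T := (th_gen X).
Local Notation str := (th_str X).
Local Notation res := (th_res X).

Lemma th_res_str c : res (str c) = c. Proof. exact: th_resK. Qed.

Definition th_base_basis N (e : 'I_N -> A^o) :=
  generates str setT [set 0] e /\ free_mod str [set 0] e.

Definition th_gen_basis N (e : 'I_N -> A^o) :=
  generates (th_cst X) setT [set 0] (fun i => th_inj X (e i) : T^o) /\
  free_mod (th_cst X) [set 0] (fun i => th_inj X (e i) : T^o).

(* The spans of the tails of [e] form a flag of ideals of [A], each of which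
   the maximal ideal maps into the next one. *)
Definition is_flag N (e : 'I_N -> A^o) :=
  forall i a, res a = 0 -> exists2 c : 'I_N -> F,
    a * e i = comb str c e & forall j : 'I_N, (j <= i)%N -> c j = 0.

Lemma exists_th_basis : exists N (e : 'I_N -> A^o),
  th_base_basis e /\ th_gen_basis e.
Proof.
have [N [e [hA hT]]] := th_basis X; exists N, e; split; split.
- split=> // a _; have [c [ac _]] := hA a; exists (fun i => c 0 i) => /=.
  by rewrite [X in X - _]ac; apply: subrr.
- move=> c /= hc i; have [d [_ ud]] := hA 0.
  have dc : d = \row_i c i.
    by apply: ud; rewrite -[LHS]hc; apply: eq_bigr => j _; rewrite mxE.
  have d0 : d = 0.
    by apply: ud; rewrite big1 // => j _; rewrite mxE rmorph0 mul0r.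
  by have := congr1 (fun v : 'rV_N => v 0 i) dc; rewrite d0 !mxE.
- split=> // a _; have [c [ac _]] := hT a; exists (fun i => c 0 i) => /=.
  by rewrite [X in X - _]ac; apply: subrr.
move=> c /= hc i; have [d [_ ud]] := hT 0.
have dc : d = \row_i c i.
  by apply: ud; rewrite -[LHS]hc; apply: eq_bigr => j _; rewrite mxE.
have d0 : d = 0.
  by apply: ud; rewrite big1 // => j _; rewrite mxE rmorph0 mul0r.
by have := congr1 (fun v : 'rV_N => v 0 i) dc; rewrite d0 !mxE.
Qed.

(** The transition matrices have entries in [F] and are mutually inverse, so they also work over the
    function field. This transfers the tensor product property from the given basis to a flag
    basis. *)
Lemma th_gen_basis_change N (e : 'I_N -> A^o) M (f : 'I_M -> A^o) :
  th_base_basis e -> th_gen_basis e -> th_base_basis f -> th_gen_basis f.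
Proof.
move=> [ge fe] [gT fT] [gf ff].
have [P /= hP] := generates_family ge (proj1 gf).
have [Q /= hQ] := generates_family gf (proj1 ge).
have Pf i : f i = comb str (P i) e by apply/eqP; rewrite -subr_eq0; apply/eqP.
have Qe i : e i = comb str (Q i) f by apply/eqP; rewrite -subr_eq0; apply/eqP.
have injc k (c : 'I_k -> F) (b : 'I_k -> A^o) :
    th_inj X (comb str c b) =
    comb (th_cst X) (fun j => cst C (c j)) (fun j => th_inj X (b j) : T^o).
  by rewrite rmorph_sum; apply: eq_bigr => j _; rewrite rmorphM th_compat.
split; first split=> // u _.
  have [_ /(_ u I) [c /= hc]] := gT.
  exists (fun j => \sum_i c i * cst C (Q i j)) => /=.
  rewrite comb_mulmx -[RHS]hc; congr (_ - _); apply: eq_bigr => i _.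
  by rewrite -injc -Qe.
move=> x /= hx.
have xP j : \sum_i x i * cst C (P i j) = 0.
  move: j; apply: fT => /=; rewrite comb_mulmx -[RHS]hx.
  by apply: eq_bigr => i _; rewrite -injc -Pf.
have PQ i l : \sum_j P i j * Q j l = (i == l)%:R.
  apply/eqP; rewrite -subr_eq0; apply/eqP; move: l; apply: ff.
  rewrite /= combB comb_delta comb_mulmx [X in _ - X]Pf.
  by under eq_bigr do rewrite -Qe; apply: subrr.
move=> l; have -> : x l = \sum_i x i * cst C (\sum_j P i j * Q j l).
  rewrite (bigD1 l) //= PQ eqxx rmorph1 mulr1 big1 ?addr0 // => i /negPf il.
  by rewrite PQ il rmorph0 mulr0.
under eq_bigr do rewrite rmorph_sum mulr_sumr.
rewrite exchange_big big1 // => j _; under eq_bigr do rewrite rmorphM mulrA.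
by rewrite -mulr_suml xP mul0r.
Qed.

(** Multiplying by the largest power of each [g] in turn that stays outside [I] yields an element
    killed by all of [l] modulo [I]. *)
Lemma nilpotent_step (I : set A) (l : seq A) a :
  (forall g b, I b -> I (g * b)) -> ~ I a ->
  (forall g, g \in l -> exists k, I (g ^+ k * a)) ->
  exists2 b, ~ I b & (exists h, b = h * a) /\ forall g, g \in l -> I (g * b).
Proof.
move=> idI; elim: l a => [a nIa _|g l IH a nIa nil].
  by exists a => //; split=> //; exists 1; rewrite mul1r.
have [|b nIb [[h bh] lb]] := IH a nIa; first by move=> f fl; apply: nil;
  rewrite inE fl orbT.
have exk : exists k, `[< I (g ^+ k * b) >].
  have [k hk] := nil g (mem_head _ _); exists k; apply/asboolP.
  by rewrite bh mulrCA; apply: idI.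
case: (ex_minnP exk) => -[|k] /asboolP; first by rewrite mul1r.
move=> Ik min; exists (g ^+ k * b).
  by move=> Ib; have := min k; rewrite ltnn => /(_ (asboolT Ib)).
split; first by exists (g ^+ k * h); rewrite bh mulrA.
move=> f; rewrite inE => /orP[/eqP ->|fl]; first by rewrite mulrA -exprS.
by rewrite mulrCA; apply: idI; apply: lb.
Qed.

Lemma th_maximal_ideal N (e : 'I_N -> A^o) a : th_base_basis e -> res a = 0 ->
  exists c : 'I_N -> F, a = \sum_i str (c i) * (e i - str (res (e i))).
Proof.
move=> [[_ /(_ a I) [c /= hc]] _] ra.
have ac : a = \sum_i str (c i) * e i by apply/eqP; rewrite -subr_eq0; apply/eqP.
exists c; under eq_bigr do rewrite mulrBr.
rewrite sumrB -ac; suff ->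
  : \sum_i str (c i) * str (res (e i)) = 0 by rewrite subr0.
under eq_bigr do rewrite -rmorphM.
rewrite -rmorph_sum (_ : \sum_i _ =
  0) ?rmorph0 // -[RHS]ra [in RHS]ac rmorph_sum.
by apply: eq_bigr => i _; rewrite rmorphM th_res_str.
Qed.

Lemma flag_span_ideal k (f : 'I_k -> A^o) a b : is_flag f ->
  (exists c, b = comb str c f) -> exists c, a * b = comb str c f.
Proof.
move=> ff [c ->].
have /choice [d hd] i : exists d, (a - str (res a)) * f i = comb str d f.
  have [|d ? _] := ff i (a - str (res a)); last by exists d.
  by rewrite rmorphB th_res_str subrr.
exists (fun j => res a * c j + \sum_i c i * d i j).
transitivity (str (res a) * comb str c f + (a - str (res a)) * comb str c f).
  by rewrite -mulrDl addrCA subrr addr0.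
rewrite [in RHS]/comb; under [RHS]eq_bigr do rewrite rmorphD scalerDl.
rewrite big_split -/(comb str (fun j => res a * c j) f) -combZ; congr (_ + _).
rewrite -/(comb str (fun j => \sum_i c i * d i j) f) comb_mulmx.
rewrite [in LHS]/comb mulr_sumr; apply: eq_bigr => i _.
by rewrite -hd; exact: mulrCA.
Qed.

(** The span of [f] is an ideal; the new first vector represents a nonzero element of the socle of
    the quotient, so the maximal ideal sends it into that span. *)
Lemma extend_flag N (e : 'I_N -> A^o) k (f : 'I_k -> A^o) :
  th_base_basis e -> free_mod str [set 0] f -> is_flag f ->
  ~ generates str setT [set 0] f ->
  exists f' : 'I_k.+1 -> A^o, free_mod str [set 0] f' /\ is_flag f'.
Proof.
move=> be free_f flag_f ngen.
have [a na] : exists a : A, ~ exists c, a = comb str c f.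
  apply: contrapT => h; apply: ngen; split=> // a _; apply: contrapT => na.
  by apply: h; exists a => -[c ac]; apply: na; exists c; rewrite /= ac subrr.
pose I := [set b : A | exists c, b = comb str c f].
have idI g b : I b -> I (g * b) by exact: flag_span_ideal.
pose l := [seq e i - str (res (e i)) | i <- enum 'I_N].
have [|b nIb [_ lb]] := @nilpotent_step I l a idI na.
  move=> g /mapP [i _ ->];
    have [|k0 hk0] := @th_nil _ _ X (e i - str (res (e i))).
    by rewrite rmorphB th_res_str subrr.
  exists k0; rewrite hk0 mul0r; exists (fun=> 0); rewrite /comb big1 // => j _.
  by rewrite rmorph0 scale0r.
have lift_comb c : comb str c f =
    comb str (fun i => oapp c 0 (unlift ord0 i)) (extend_family f b).
  rewrite [RHS]/comb big_ord_recl unlift_none /= rmorph0 scale0r add0r.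
  by apply: eq_bigr => i _; rewrite liftK extend_family_lift.
exists (extend_family f b); split; first exact: extend_family_free.
move=> i; case: (unliftP ord0 i) => [j ->|->] g g0.
  have [c hc c0] := flag_f j g g0.
  exists (fun i => oapp c 0 (unlift ord0 i)).
    by rewrite extend_family_lift hc lift_comb.
  by move=> m; case: unliftP => [m' ->|//] /=; rewrite /bump !leq0n /= ltnS;
    exact: c0.
have [d gd] := th_maximal_ideal be g0.
have [c hc] : I (g * b).
  rewrite gd mulr_suml; apply: (@submodule_sum _ _ str A^o I) => [|i0].
    split=> [|u v [c ->] [c' ->]|r u]; last exact: idI.
      by exists (fun=> 0); rewrite /comb big1 // => j _;
        rewrite rmorph0 scale0r.
    by exists (fun j => c j + c' j); rewrite /comb -big_split;
      apply: eq_bigr => j _; rewrite rmorphD scalerDl.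
  rewrite -mulrA; apply/idI/lb/mapP; exists i0 => //; exact: mem_enum.
exists (fun i => oapp c 0 (unlift ord0 i)).
  by rewrite extend_family0 hc lift_comb.
by move=> m; rewrite leqn0 => /eqP m0; rewrite (_ : m = ord0) ?unlift_none //;
  exact: val_inj.
Qed.

Lemma exists_flag_basis : exists N (e : 'I_N -> A^o),
  [/\ th_base_basis e, th_gen_basis e & is_flag e].
Proof.
have [N [e [be bT]]] := exists_th_basis.
suff [k [f [gf ff fl]]] : exists k (f : 'I_k -> A^o),
    [/\ generates str setT [set 0] f, free_mod str [set 0] f & is_flag f].
  by exists k, f; split=> //; apply: th_gen_basis_change be bT _.
apply: contrapT => nex.
have all_k k : exists f : 'I_k -> A^o, free_mod str [set 0] f /\ is_flag f.
  elim: k => [|k [f [ff fl]]]; first by exists (fun=> 0); split=> [c _|] [].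
  by apply: (extend_flag be ff fl) => gf; apply: nex; exists k, f.
have [f [ff _]] := all_k N.+1; have [ge _] := be.
by have := free_le_generators ge (fun _ => I) ff; rewrite ltnn.
Qed.

End FlagBasis.

Section Thickening.
Variables (F : fieldType) (C : curve F) (X : thickening C).
Local Notation A := (th_base X).
Local Notation T := (th_gen X).
Local Notation str := (th_str X).
Local Notation res := (th_res X).
Local Notation gres := (th_gres X).
Local Notation inj := (th_inj X).
Local Notation tcst := (th_cst X).
Local Notation gresM := (map_mx gres).
Local Notation cstM := (map_mx tcst).

Lemma th_gres_cst x : gres (tcst x) = x. Proof. exact: th_gresK. Qed.

Lemma gresM_cst m n (x : 'M[C]_(m, n)) : gresM (cstM x) = x.
Proof. by apply/matrixP => i j; rewrite !mxE th_gres_cst. Qed.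

Lemma gresM_sum m n (I : finType) (x : I -> 'M[T]_(m, n)) :
  gresM (\sum_i x i) = \sum_i gresM (x i).
Proof.
by apply: (big_morph gresM) => [u v|]; [exact: map_mxD|exact: map_mx0].
Qed.

Lemma th_Oring_inj p a : @th_Oring _ _ X p (inj a).
Proof.
exists 1%N, (fun=> a), (fun=> 1); split=> [_|]; first exact: Oring1.
by rewrite big_ord1 rmorph1 mulr1.
Qed.

Lemma th_Oring_cst p x : Oring p x -> @th_Oring _ _ X p (tcst x).
Proof.
move=> px; exists 1%N, (fun=> 1), (fun=> x); split=> //.
by rewrite big_ord1 rmorph1 mul1r.
Qed.

Lemma th_Oring_gres p u : @th_Oring _ _ X p u -> Oring p (gres u).
Proof.
move=> [q [a [f [pf ->]]]]; rewrite rmorph_sum; apply: Oring_sum => i.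
by rewrite rmorphM th_gres_inj th_gres_cst; apply: OringM => //;
  exact: Oring_cst.
Qed.

Lemma integral_gres p m n (M : 'M[T]_(m, n)) :
  integral (@th_Oring _ _ X) p M -> integral (@Oring F C) p (gresM M).
Proof. by move=> h i j; rewrite mxE; exact: th_Oring_gres. Qed.

Lemma integral_cst p m n (M : 'M[C]_(m, n)) :
  integral (@Oring F C) p M -> integral (@th_Oring _ _ X) p (cstM M).
Proof. by move=> h i j; rewrite mxE; exact: th_Oring_cst. Qed.

Section Coordinates.
Variables (N : nat) (e : 'I_N -> A^o).
Hypotheses (be : th_base_basis e) (bT : th_gen_basis e).
Local Notation ie := (fun i => inj (e i) : T^o).

Definition co (u : T) : 'I_N -> C := sval (cid (proj2 (proj1 bT) u I)).

Lemma coE u : u = comb tcst (co u) ie.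
Proof.
by rewrite /co; case: cid => c /= hc; apply/eqP; rewrite -subr_eq0; apply/eqP.
Qed.

Lemma co_uniq u c : u = comb tcst c ie -> forall i, co u i = c i.
Proof.
move=> uc i; apply/eqP; rewrite -subr_eq0; apply/eqP; move: i;
  apply: (proj2 bT).
by rewrite /= combB -coE [X in X - _]uc subrr.
Qed.

Lemma coB u v i : co (u - v) i = co u i - co v i.
Proof. by apply: (@co_uniq _ (fun i => co u i - co v i));
  rewrite combB -!coE. Qed.

Lemma co0 i : co 0 i = 0.
Proof. by have := coB 0 0 i; rewrite !subrr. Qed.

Lemma coN u i : co (- u) i = - co u i.
Proof. by rewrite -[- u]add0r coB co0 add0r. Qed.

Lemma coD u v i : co (u + v) i = co u i + co v i.
Proof. by rewrite -[v in LHS]opprK coB coN opprK. Qed.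

Lemma co_sum (I : finType) (u : I ->
  T) i : co (\sum_j u j) i = \sum_j co (u j) i.
Proof.
by apply: (big_morph (fun u => co u i)) => [u1 u2|]; [exact: coD|exact: co0].
Qed.

Lemma coZ x u i : co (tcst x * u) i = x * co u i.
Proof. by apply: (@co_uniq _ (fun i => x * co u i)); rewrite -combZ -coE. Qed.

Lemma co_inj a : exists2 c : 'I_N -> F, a = comb str c e &
  forall i, co (inj a) i = cst C (c i).
Proof.
have [_ /(_ a I) [c /= hc]] := proj1 be.
have ac : a = comb str c e by apply/eqP; rewrite -subr_eq0; apply/eqP.
exists c => //; apply: (@co_uniq _ (fun i => cst C (c i)));
  rewrite [in LHS]ac rmorph_sum.
by apply: eq_bigr => j _; rewrite rmorphM th_compat.
Qed.

(** Elements of A have coordinates in [F], hence [e] is also a basis of A (x) O_p over O_p. *)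
Lemma th_OringP p u : @th_Oring _ _ X p u <-> forall i, Oring p (co u i).
Proof.
split=> [[q [a [f [pf ->]]]] i|h].
  rewrite co_sum; apply: Oring_sum => j; rewrite mulrC coZ; apply: OringM => //.
  by have [c _ ->] := co_inj (a j); exact: Oring_cst.
exists N, e, (co u); split=> //; rewrite [LHS]coE.
by apply: eq_bigr => i _; exact: mulrC.
Qed.

Lemma gres_kernel u : gres u = 0 ->
  u = \sum_i inj (e i - str (res (e i))) * tcst (co u i).
Proof.
move=> u0; under eq_bigr do rewrite rmorphB mulrBl.
rewrite sumrB [LHS]coE; under eq_bigr do rewrite mulrC.
have -> : \sum_i inj (str (res (e i))) * tcst (co u i) = 0;
  last by rewrite subr0.
under eq_bigr do rewrite th_compat -rmorphM.
rewrite -rmorph_sum (_ : \sum_i _ = 0) ?rmorph0 // -[RHS]u0 [in RHS](coE u).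
rewrite rmorph_sum; apply: eq_bigr => i _.
by rewrite rmorphM th_gres_inj th_gres_cst mulrC.
Qed.

Lemma th_Oring_subring p : is_subring (@th_Oring _ _ X) p.
Proof.
have Osum (I : finType) (u : I -> T) :
    (forall i, @th_Oring _ _ X p (u i)) -> @th_Oring _ _ X p (\sum_i u i).
  by move=> h; apply/th_OringP => i; rewrite co_sum; apply: Oring_sum => j;
    have /th_OringP := h j.
split; first by rewrite -(rmorph1 inj); exact: th_Oring_inj.
  move=> u v /th_OringP hu /th_OringP hv; apply/th_OringP => i.
  by rewrite coB; exact: OringB.
move=> u v [q [a [f [pf ->]]]] [q' [a' [f' [pf' ->]]]].
rewrite mulr_suml; apply: (Osum) => i; rewrite mulr_sumr; apply: (Osum) => j.
exists 1%N, (fun=> a i * a' j), (fun=> f i * f' j); split=> [_|];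
  first exact: OringM.
by rewrite big_ord1 !rmorphM mulrACA.
Qed.

Section Flag.
Hypothesis fe : is_flag e.

(** The flag ideal spanned by the [e j] with [k <= j], tensored with the function field. *)
Definition Fil (k : nat) (u : T) := forall j : 'I_N, (j < k)%N -> co u j = 0.

Lemma Fil_top u : Fil N u -> u = 0.
Proof.
move=> h; rewrite [LHS]coE /comb big1 // => i _.
by rewrite h // rmorph0 scale0r.
Qed.

(** [w] differs from the constant [gres w] by an element of the maximal ideal, which pushes [u] one
    step further in the filtration. The case [l = k] says that leading coefficients are
    multiplicative. *)
Lemma co_mul k u w (l : 'I_N) : Fil k u -> (l <= k)%N ->
  co (u * w) l = co u l * gres w.
Proof.
move=> hu lk; rewrite -[w in LHS](subrK (tcst (gres w))) mulrDr coD.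
rewrite [u * tcst _]mulrC coZ [gres w * _]mulrC.
rewrite [X in X + _](_ : _ = 0) ?add0r //.
have w0 : gres (w - tcst (gres w)) = 0 by rewrite rmorphB th_gres_cst subrr.
rewrite (gres_kernel w0) mulr_sumr co_sum; apply: big1 => i _.
rewrite mulrA mulrC coZ [z in z * inj _](coE u) mulr_suml co_sum big1 ?mulr0
  // => j _.
have [jk|kj] := ltnP j k; first by rewrite hu // rmorph0 scale0r mul0r co0.
rewrite -[_ *: _]/(tcst (co u j) * inj (e j)) -mulrA coZ -rmorphM.
have [|c eg c0] := @fe j (e i - str (res (e i))).
  by rewrite rmorphB th_res_str subrr.
rewrite [e j * _]mulrC eg; have [d cd ->] := co_inj (comb str c e).
have -> : d l = c l; last by rewrite c0 ?rmorph0 ?mulr0 // (leq_trans lk).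
apply/eqP; rewrite eq_sym -subr_eq0; apply/eqP; move: l lk => l _; move: l.
by apply: (proj2 be); rewrite /= combB cd subrr.
Qed.

Definition coM k m n (x : 'M[T]_(m, n)) : 'M[C]_(m, n) := map_mx (co^~ k) x.

Definition FilM k m n (x : 'M[T]_(m, n)) := forall i j, Fil k (x i j).

Lemma coMD k m n (x y : 'M[T]_(m, n)) : coM k (x + y) = coM k x + coM k y.
Proof. by apply/matrixP => i j; rewrite !mxE coD. Qed.

Lemma coMB k m n (x y : 'M[T]_(m, n)) : coM k (x - y) = coM k x - coM k y.
Proof. by apply/matrixP => i j; rewrite !mxE coB. Qed.

Lemma coM_sum k m n (I : finType) (x : I -> 'M[T]_(m, n)) :
  coM k (\sum_i x i) = \sum_i coM k (x i).
Proof.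
apply: (big_morph (@coM k m n)) => [u v|]; first exact: coMD.
by apply/matrixP => i j; rewrite !mxE co0.
Qed.

Lemma coM_mul (k : 'I_N) m n l (x : 'M[T]_(m, n)) (M : 'M[T]_(n, l)) :
  FilM k x -> coM k (x *m M) = coM k x *m gresM M.
Proof.
move=> hx; apply/matrixP => i j; rewrite !mxE co_sum; apply: eq_bigr => a _.
by rewrite !mxE (@co_mul k).
Qed.

Lemma coM_scale (k : 'I_N) m n a (x : 'M[T]_(m, n)) :
  Fil k a -> coM k (a *: x) = co a k *: gresM x.
Proof. by move=> ha; apply/matrixP => i j; rewrite !mxE (@co_mul k). Qed.

Lemma FilMD k m n (x y : 'M[T]_(m, n)) : FilM k x -> FilM k y -> FilM k (x + y).
Proof. by move=> hx hy i j l lk; rewrite mxE coD hx // hy // addr0. Qed.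

Lemma FilMB k m n (x y : 'M[T]_(m, n)) : FilM k x -> FilM k y -> FilM k (x - y).
Proof. by move=> hx hy i j l lk; rewrite !mxE coB hx // hy // subr0. Qed.

Lemma FilM_sum k m n (I : finType) (x : I -> 'M[T]_(m, n)) :
  (forall i, FilM k (x i)) -> FilM k (\sum_i x i).
Proof.
move=> h; apply: (big_ind (@FilM k m n)) => //; last by move=> u v;
  exact: FilMD.
by move=> i j l lk; rewrite mxE co0.
Qed.

Lemma FilM_scale k m n a (x : 'M[T]_(m, n)) : Fil k a -> FilM k (a *: x).
Proof. by move=> ha i j l lk;
  rewrite mxE (co_mul _ ha (ltnW lk)) ha // mul0r. Qed.

Lemma FilM_mul k m n l (x : 'M[T]_(m, n)) (M : 'M[T]_(n, l)) :
  FilM k x -> FilM k (x *m M).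
Proof.
move=> hx i j a ak; rewrite mxE co_sum big1 // => b _.
by rewrite (co_mul _ (hx i b) (ltnW ak)) hx // mul0r.
Qed.

Lemma FilMS (k : 'I_N) m n (x : 'M[T]_(m, n)) :
  FilM k x -> coM k x = 0 -> FilM k.+1 x.
Proof.
move=> hx x0 i j l; rewrite ltnS leq_eqVlt => /orP[/eqP/val_inj ->|];
  last exact: hx.
by have /matrixP/(_ i j) := x0; rewrite !mxE.
Qed.

Lemma co_basis (k : 'I_N) c (l : 'I_N) : (l <= k)%N ->
  co (inj (str c * e k)) l = (l == k)%:R * cst C c.
Proof.
move=> lk; rewrite rmorphM th_compat coZ.
rewrite (@co_uniq _ (fun i => (k == i)%:R)) 1?comb_delta //.
by rewrite eq_sym mulrC.
Qed.

Lemma Fil_basis (k : 'I_N) c : Fil k (inj (str c * e k)).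
Proof.
move=> l lk; rewrite co_basis ?(ltnW lk) // (_ : (l == k) = false) ?mul0r //.
by apply/negbTE; rewrite -val_eqE neq_ltn lk.
Qed.

End Flag.
End Coordinates.
End Thickening.

(** * Stalks, and relations in the first cohomology *)

Lemma comb_fct (P : Type) (S T : nzRingType) (sigma : {rmorphism S -> T})
    (V : lmodType T) q (c : 'I_q -> S) (s : 'I_q -> P -> V) p :
  comb sigma c s p = comb sigma c (s^~ p).
Proof. by rewrite /comb fct_sumE. Qed.

Section Stalks.
Variables (P : Type) (T : comNzRingType) (O : P -> set T).
Hypothesis O_subring : forall p, is_subring O p.
Variables (n : nat) (E : bundle O n).

Lemma stalk0 p : stalk E p 0.
Proof. by rewrite /stalk /= mul0mx => i j; rewrite mxE; exact: subring0. Qed.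

Lemma stalkB p x y : stalk E p x -> stalk E p y -> stalk E p (x - y).
Proof. by rewrite /stalk /= mulmxBl; exact: integralB. Qed.

Lemma stalkD p x y : stalk E p x -> stalk E p y -> stalk E p (x + y).
Proof. by rewrite /stalk /= mulmxDl; exact: integralD. Qed.

Lemma stalkZ p a x : O p a -> stalk E p x -> stalk E p (a *: x).
Proof. by rewrite /stalk /= -scalemxAl; exact: integralZ. Qed.

Lemma stalk_sum p (I : finType) (x : I -> 'rV_n) :
  (forall i, stalk E p (x i)) -> stalk E p (\sum_i x i).
Proof.
by move=> h; apply: (big_ind (stalk E p)) => //; [exact: stalk0|exact: stalkD].
Qed.

Lemma integral_stalk p x : integral O p (fr E p) -> stalk E p x ->
  integral O p x.
Proof.
move=> hf Ex; rewrite -[x]mulmx1 -(mulmx1C (fr_cofr E p)) mulmxA.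
exact: integralM.
Qed.

Lemma H1rel_submodule (S : nzRingType) (sigma : {rmorphism S -> T}) :
  (forall p a, O p (sigma a)) -> submodule sigma (H1rel E).
Proof.
move=> Oa; split=> [|a b [x hx] [y hy]|r a [x hx]].
- by exists 0 => p; rewrite subrr; exact: stalk0.
- exists (x + y) => p.
  have -> : (a + b) p - (x + y) =
    (a p - x) + (b p - y) by rewrite opprD addrACA.
  exact: stalkD.
by exists (sigma r *: x) => p; rewrite -scalerBr; exact: stalkZ.
Qed.

Lemma H1rel_combP (S : nzRingType) (sigma : {rmorphism S -> T}) h
    (c : 'I_h -> S) (s : 'I_h -> P -> 'rV_n) :
  H1rel E (comb sigma c s) <->
  exists x, forall p, stalk E p (comb sigma c (s^~ p) - x).
Proof. by split=> -[x hx]; exists x => p; have := hx p; rewrite comb_fct. Qed.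

Lemma H1rel_subP (S : nzRingType) (sigma : {rmorphism S -> T}) u h
    (c : 'I_h -> S) (s : 'I_h -> P -> 'rV_n) :
  H1rel E (u - comb sigma c s) <->
  exists x, forall p, stalk E p (u p - comb sigma c (s^~ p) - x).
Proof.
split=> -[x hx]; exists x => p; have := hx p.
  by rewrite -[(u - _) p]/(u p - comb sigma c s p) comb_fct.
by rewrite -[(u - _) p]/(u p - comb sigma c s p) comb_fct.
Qed.

End Stalks.

(** * Cohomology of a deformation *)

Section Deformation.
Variables (F : fieldType) (C : curve F) (X : thickening C).
Local Notation A := (th_base X).
Local Notation T := (th_gen X).
Local Notation str := (th_str X).
Local Notation res := (th_res X).
Local Notation gres := (th_gres X).
Local Notation inj := (th_inj X).
Local Notation tcst := (th_cst X).
Local Notation gresM := (map_mx gres).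
Local Notation cstM := (map_mx tcst).
Local Notation O := (@Oring F C).
Local Notation TO := (@th_Oring F C X).
Variables (N : nat) (e : 'I_N -> A^o).
Hypotheses (be : th_base_basis e) (bT : th_gen_basis e).
Variables (n : nat) (E : vbundle C n) (EX : th_bundle X n) (H H' : 'M[C]_n).
Hypothesis HH' : H *m H' = 1%:M.
Hypothesis iso : forall p,
  integral O p (gresM (fr EX p) *m H *m cofr E p) /\
  integral O p (fr E p *m H' *m gresM (cofr EX p)).

Let H'H : H' *m H = 1%:M. Proof. exact: mulmx1C. Qed.
Let sO p : is_subring O p. Proof. exact: Oring_subring. Qed.
Let sTO p : is_subring TO p. Proof. exact: th_Oring_subring be bT p. Qed.

Let fcE p : cofr E p *m fr E p = 1%:M. Proof. exact: mulmx1C (fr_cofr E p). Qed.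
Let fcEX p : cofr EX p *m fr EX p = 1%:M.
Proof. exact: mulmx1C (fr_cofr EX p). Qed.
Let gfcEX p : gresM (cofr EX p) *m gresM (fr EX p) = 1%:M.
Proof. by rewrite -map_mxM fcEX map_mx1. Qed.

(** The lift with constant coordinates in the local basis of [EX], so that it stays in the stalk. *)
Definition lift_stalk p (z : 'rV[C]_n) : 'rV[T]_n :=
  cstM (z *m H' *m gresM (cofr EX p)) *m fr EX p.

Lemma gres_lift_stalk p z : gresM (lift_stalk p z) = z *m H'.
Proof. by rewrite map_mxM gresM_cst -mulmxA gfcEX mulmx1. Qed.

Lemma lift_stalkP p z : stalk E p z -> stalk EX p (lift_stalk p z).
Proof.
move=> hz; rewrite /stalk /= /lift_stalk -mulmxA fr_cofr mulmx1.
apply: integral_cst.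
have -> : z *m H' *m gresM (cofr EX p) =
    (z *m cofr E p) *m (fr E p *m H' *m gresM (cofr EX p)).
  by rewrite -!mulmxA (mulmxA (cofr E p)) fcE mul1mx.
by apply: integralM; [exact: sO| |have [] := iso p].
Qed.

Definition good_place p :=
  (integral O p (fr E p) /\ integral O p (cofr E p)) /\
  (integral TO p (fr EX p) /\ integral TO p (cofr EX p)).

Lemma good_places_ae : finite_set [set p | ~ good_place p].
Proof.
apply: (@sub_finite_set _ _
  ([set p | ~ (integral O p (fr E p) /\ integral O p (cofr E p))] `|`
   [set p | ~ (integral TO p (fr EX p) /\ integral TO p (cofr EX p))])).
  by move=> p /= /not_andP.
by rewrite finite_setU; split; exact: bundle_ae.
Qed.

Lemma good_integral_iso p : good_place p -> integral O p H /\ integral O p H'.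
Proof.
move=> [[hf hc] [hfX hcX]]; have [i1 i2] := iso p; split.
  have -> : H = gresM (cofr EX p) *m (gresM (fr EX p) *m H *m cofr E p) *m fr
    E p.
    by rewrite !mulmxA gfcEX mul1mx -mulmxA fcE mulmx1.
  by apply: integralM => //; apply: integralM => //; exact: integral_gres.
have -> : H' = cofr E p *m (fr E p *m H' *m gresM (cofr EX p)) *m gresM (fr EX
  p).
  by rewrite !mulmxA fcE mul1mx -mulmxA gfcEX mulmx1.
apply: integralM => //; last exact: integral_gres.
by apply: integralM.
Qed.

Lemma integral_lift_stalk p z : good_place p -> integral O p z ->
  integral TO p (lift_stalk p z).
Proof.
move=> gp hz; have [iH iH'] := good_integral_iso gp; have [_ [hfX hcX]] := gp.
apply: integralM => //; apply: integral_cst.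
by apply: integralM => //; [exact: integralM|exact: integral_gres].
Qed.

Lemma H1rel_submodule_th : submodule inj (H1rel EX).
Proof. by apply: (H1rel_submodule sTO) => p a; exact: th_Oring_inj. Qed.

Variables (h : nat) (eb : 'I_h -> place C -> 'rV[C]_n).
Hypothesis geb : generates (cst C) (adeles O (n := n)) (H1rel E) eb.

(** Here the coordinates in the generic basis are kept constant: an adele need only be integral at
    almost all places. *)
Definition lift_adele (a : place C ->
  'rV[C]_n) p : 'rV[T]_n := cstM (a p *m H').

Local Notation et := (fun i => lift_adele (eb i)).

Lemma lift_adeleP a : adeles O a -> adeles TO (lift_adele a).
Proof.
move=> ha; apply: (@sub_finite_set _ _
  ([set p | ~ good_place p] `|` [set p | ~ integral O p (a p)])).
  2: by rewrite finite_setU; split; [exact: good_places_ae|].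
move=> p /= hp; apply: contrapT => /not_orP [/contrapT gp /contrapT ap];
  apply: hp.
have [_ iH'] := good_integral_iso gp.
by apply: integral_cst; exact: integralM.
Qed.

Section Generation.
Hypothesis fe : is_flag e.

(** Nakayama's lemma along the flag, [d] being the number of steps left. The leading coefficient of
    [u] is an adele of [E]; expressing its class on [eb] and lifting the expression moves [u] one
    step down. *)
Lemma lift_generates_Fil d : (d <= N)%N -> forall u, adeles TO u ->
  (forall p, FilM bT (N - d) (u p)) ->
  exists c : 'I_h -> A, H1rel EX (u - comb inj c et).
Proof.
elim: d => [_ u _ u0|d IH dN u uA uF].
  exists (fun=> 0); suff -> : u - comb inj (fun=> 0) et = 0.
    by have [] := H1rel_submodule_th.
  apply/funext => p; rewrite /comb big1 ?subr0 => [|i _];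
    last by rewrite rmorph0 scale0r.
  by apply/matrixP => i j; rewrite mxE; apply: (Fil_top (bT := bT));
    have := u0 p i j; rewrite subn0.
have kN : (N - d.+1 < N)%N by lia.
pose k := Ordinal kN.
have wA : adeles O (fun p => coM bT k (u p) *m H).
  apply: (@sub_finite_set _ _
    ([set p | ~ good_place p] `|` [set p | ~ integral TO p (u p)])).
    2: by rewrite finite_setU; split; [exact: good_places_ae|].
  move=> p /= hp; apply: contrapT => /not_orP [/contrapT gp /contrapT up];
    apply: hp.
  have [iH _] := good_integral_iso gp; apply: integralM => // i j.
  by rewrite mxE; have /(th_OringP be bT) := up i j; apply.
set w := (fun p => _) in wA.
have [_ /(_ _ wA) [al /H1rel_subP [x hx]]] := geb.
pose y p := w p - comb (cst C) al (eb^~ p) - x.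
have Ey p : stalk E p (y p) by exact: hx.
pose c1 j : A := str (al j) * e k.
pose ek : T := inj (str 1 * e k).
(* A lift of [w p] term by term: the combination of classes, the rational vector, and the element of
   the stalk. *)
pose v p := comb tcst (fun j => cst C (al j)) (fun j =>
  et j p) + cstM (x *m H') + lift_stalk p (y p).
pose u' p := u p - ek *: v p.
have gv p : gresM (v p) *m H = w p.
  have hc : gresM (comb tcst (fun j => cst C (al j)) (et^~ p)) *m H =
      comb (cst C) al (eb^~ p).
    rewrite /comb gresM_sum mulmx_suml; apply: eq_bigr => j _.
    by rewrite map_mxZ -scalemxAl th_gres_cst gresM_cst -mulmxA H'H mulmx1.
  rewrite /v !map_mxD gres_lift_stalk gresM_cst !mulmxDl hc -!mulmxA H'H
    !mulmx1.
  by rewrite /y -[w p - _ - x]addrA -opprD [LHS]addrC subrK.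
have u'F p : FilM bT (N - d) (u' p).
  have -> : (N - d = k.+1)%N by rewrite /=; lia.
  have Fk : FilM bT k (ek *: v p) by apply: (FilM_scale be fe);
    exact: Fil_basis.
  apply: FilMS; first by apply: FilMB => //; exact: uF.
  rewrite coMB (coM_scale be fe) ?co_basis // ?eqxx; last exact: Fil_basis.
  rewrite rmorph1 mulr1 scale1r; apply/eqP; rewrite subr_eq0; apply/eqP.
  by rewrite -[LHS]mulmx1 -HH' mulmxA -/(w p) -gv -mulmxA HH' mulmx1.
have u'A : adeles TO u'.
  apply: (@sub_finite_set _ _ ([set p | ~ good_place p] `|`
      ([set p | ~ integral TO p (u p)] `|` ([set p | ~ integral O p (w p)] `|`
        \bigcup_(j in [set: 'I_h]) [set p | ~ integral O p (eb j p)])))).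
    2: {
      rewrite !finite_setU; split; first exact: good_places_ae.
      split; first exact: uA.
      split; first exact: wA.
      by apply: bigcup_finite => [|j _];
        [exact: finite_finset|exact: (proj1 geb)].
    }
  move=> p /= hp; apply: contrapT => /not_orP [/contrapT gp].
  move=> /not_orP [/contrapT up] /not_orP [/contrapT wp ebp']; apply: hp.
  have ebp j : integral O p (eb j p).
    by apply: contrapT => hj; apply: ebp'; exists j.
  have [[hf _] _] := gp; have [iH iH'] := good_integral_iso gp.
  have yp : integral O p (y p) by apply: integral_stalk (Ey p) => //.
  have cp : integral O p (comb (cst C) al (eb^~ p)).
    by apply: integral_sum => // j; apply: integralZ => //; exact: Oring_cst.
  have xp : integral O p x.
    have -> : x = w p - comb (cst C) al (eb^~ p) - y p by rewrite /y subKr.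
    by do 2?[apply: integralB => //].
  apply: integralB => //; apply: integralZ => //; first exact: th_Oring_inj.
  apply: integralD => //; last exact: integral_lift_stalk.
  apply: integralD => //; last by apply: integral_cst; exact: integralM.
  apply: integral_sum => // j; apply: integralZ => //.
    by apply: th_Oring_cst; exact: Oring_cst.
  by apply: integral_cst; exact: integralM.
have [c' /H1rel_subP [x' hx']] := IH (ltnW dN) u' u'A u'F.
exists (fun j => c' j + c1 j); apply/H1rel_subP.
exists (x' + ek *: cstM (x *m H')) => p; have h1 := hx' p.
have h2 : stalk EX p (ek *: lift_stalk p (y p)).
  by apply: stalkZ => //; [exact: th_Oring_inj|exact: lift_stalkP].
have := stalkD sTO h1 h2; congr (stalk EX p _).
have -> : u p = u' p + ek *: v p by rewrite /u' subrK.
have -> : comb inj (fun j => c' j + c1 j) (et^~ p) =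
    comb inj c' (et^~ p) + ek *: comb tcst (fun j => cst C (al j)) (et^~ p).
  rewrite [RHS]addrC /comb scaler_sumr -big_split; apply: eq_bigr => j _.
  rewrite rmorphD scalerDl addrC scalerA; congr (_ *: _ + _).
  by rewrite /ek /c1 2!rmorphM !th_compat !rmorph1 mul1r mulrC.
rewrite /v !scalerDr !opprD.
move: (comb inj _ _) (ek *: _) (ek *: _) (ek *: _) (u' p) => z1 z2 z3 z4 z5.
apply/rowP => i; rewrite !mxE; ring.
Qed.

Lemma lift_generates : generates inj (adeles TO (n := n)) (H1rel EX) et.
Proof.
split=> [i|u uA]; first by apply: lift_adeleP; have [] := geb.
apply: (lift_generates_Fil (leqnn N) uA) => p i j l.
by rewrite subnn.
Qed.

(* If the coefficients of a relation and its rational part [x] lie in the [k]-th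
   step of the filtration, their leading terms form a relation in [H1 E], hence
   the former vanish and [x] can be corrected by a lift of its leading term,
   which is a section of [E]. *)
Lemma lift_free k (t : 'I_k -> 'rV[C]_n) (s : 'I_k -> 'rV[T]_n) :
  free_mod (cst C) (H1rel E) eb ->
  generates (cst C) (H0 E) [set 0] t ->
  (forall i, H0 EX (s i)) -> (forall i, gresM (s i) *m H = t i) ->
  free_mod inj (H1rel EX) et.
Proof.
move=> feb gt EXs st c /H1rel_combP [x0 hx0].
have main l : (l <= N)%N -> exists x, [/\ FilM bT l x,
    forall j, Fil bT l (inj (c j)) & forall p,
      stalk EX p (comb inj c (et^~ p) - x)].
  elim: l => [_|l IH lN]; first by exists x0.
  have [x [xF cF hx]] := IH (ltnW lN); pose k0 := Ordinal lN.
  have coc j : exists a, co bT (inj (c j)) k0 = cst C a.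
    by have [d _ hd] := co_inj be bT (c j); exists (d k0).
  have [al hal] := choice coc.
  have lead p : coM bT k0 (comb inj c (et^~ p)) *m H = comb (cst C) al (eb^~ p).
    rewrite /comb coM_sum mulmx_suml; apply: eq_bigr => j _.
    rewrite (coM_scale be fe) ?hal; last exact: cF.
    by rewrite gresM_cst -scalemxAl -mulmxA H'H mulmx1.
  (* The leading coefficient of an element of the stalk of [EX] lies in the stalk of [E]: write the
     element in the local basis and reduce that basis. *)
  have Elead p : stalk E p (comb (cst C) al (eb^~ p) - coM bT k0 x *m H).
    rewrite -lead -mulmxBl -coMB.
    set y := (comb _ _ _ - x); have yF : FilM bT k0 y.
      apply: FilMB => //; apply: FilM_sum => j; exact: (FilM_scale be fe).
    have -> : y = (y *m cofr EX p) *m fr EX p by rewrite -mulmxA fcEX mulmx1.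
    rewrite (coM_mul be fe); last exact: FilM_mul.
    have i2 : integral O p (coM bT k0 (y *m cofr EX p)).
      by move=> i j; rewrite mxE; have /(th_OringP be bT) := hx p i j; apply.
    have [i1 _] := iso p; have := integralM (sO p) i2 i1.
    by rewrite !mulmxA.
  have al0 : forall j, al j = 0.
    by apply: feb; apply/H1rel_combP; exists (coM bT k0 x *m H).
  have Ex : H0 E (coM bT k0 x *m H).
    move=> p; have := Elead p; rewrite /comb big1 => [|j _];
      last by rewrite al0 rmorph0 scale0r.
    by rewrite sub0r => /(stalkB sO (stalk0 sO E p)); rewrite sub0r opprK.
  have [_ /(_ _ Ex) [b /= hb]] := gt.
  have FB i : Fil bT k0 (inj (str (b i) * e k0)) by exact: Fil_basis.
  pose z := \sum_i inj (str (b i) * e k0) *: s i.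
  have zF : FilM bT k0 z by apply: FilM_sum => i; exact: (FilM_scale be fe).
  exists (x - z); split.
  - apply: (@FilMS _ _ _ _ _ _ k0); first exact: FilMB.
    rewrite coMB; apply/eqP; rewrite subr_eq0; apply/eqP.
    rewrite -[LHS]mulmx1 -[RHS]mulmx1 -HH' !mulmxA; congr (_ *m _).
    apply/eqP; rewrite -subr_eq0; apply/eqP; rewrite -[RHS]hb; congr (_ - _).
    rewrite coM_sum mulmx_suml; apply: eq_bigr => i _.
    by rewrite (coM_scale be fe) // co_basis // eqxx mul1r -scalemxAl st.
  - move=> j i; rewrite ltnS leq_eqVlt => /orP[/eqP il|]; last exact: cF.
    by rewrite (_ : i = k0) ?hal ?al0 ?rmorph0 //; exact: val_inj.
  move=> p; rewrite opprB addrA addrAC; apply: stalkD => //.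
  apply: stalk_sum => // i; apply: stalkZ => //; first exact: th_Oring_inj.
  exact: EXs.
have [x [_ cF _]] := main N (leqnn N) => j.
have [d cd hd] := co_inj be bT (c j).
rewrite cd /comb big1 // => i _; suff -> : d i = 0 by rewrite rmorph0 scale0r.
by apply/eqP; rewrite -(fmorph_eq0 (cst C)) -hd; apply/eqP/cF.
Qed.

End Generation.

(* A section of [E] lifts locally and generically; the difference of these lifts
   is a combination of classes in [H1 EX] with coefficients in the maximal ideal,
   which freeness allows to kill. *)
Lemma lift_section s : generates inj (adeles TO (n := n)) (H1rel EX) et ->
  free_mod inj (H1rel EX) et -> H0 E s ->
  exists2 s', H0 EX s' & gresM s' *m H = s.
Proof.
move=> get fet Es; pose x0 := cstM (s *m H'); pose y p := lift_stalk p s.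
pose g i : A := e i - str (res (e i)).
have rg i : gres (inj (g i)) = 0.
  by rewrite th_gres_inj rmorphB th_res_str subrr rmorph0.
(* The generic lift [x0] and the local lift [y p] agree modulo the maximal ideal, which the [g i]
   span. *)
pose b i p := cstM (coM bT i (x0 - y p)).
have bE p : x0 - y p = \sum_i inj (g i) *: b i p.
  apply/matrixP => a j; rewrite summxE [LHS](gres_kernel bT).
    by apply: eq_bigr => i _; rewrite !mxE.
  have : gresM (x0 - y p) =
    0 by rewrite map_mxB gresM_cst gres_lift_stalk subrr.
  by move=> /matrixP/(_ a j); rewrite !mxE.
have bA i : adeles TO (b i).
  apply: sub_finite_set good_places_ae => p /= hp gp; apply: hp.
  have [[hf _] _] := gp; have [iH iH'] := good_integral_iso gp.
  have sp : integral O p s by apply: integral_stalk (Es p).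
  apply: integral_cst => a j; rewrite mxE.
  have : integral TO p (x0 - y p).
    apply: integralB => //; last exact: integral_lift_stalk.
    by apply: integral_cst; exact: integralM.
  by move=> /(_ a j) /(th_OringP be bT); apply.
have [c hc] := generates_family get bA.
have /choice [x hx] i := (H1rel_subP EX inj (b i) (c i) et).1 (hc i).
pose r j := \sum_i g i * c i j.
have rel p : comb inj r (et^~ p) =
    x0 - y p - \sum_i inj (g i) *: x i - \sum_i inj (g i) *: (b i p -
      comb inj (c i) (et^~ p) - x i).
  rewrite comb_mulmx bE -!sumrB; apply: eq_bigr => i _.
  by rewrite -!scalerBr; congr (_ *: _); apply/rowP => j; rewrite !mxE; ring.
have sz p : stalk EX p (\sum_i inj (g i) *: (b i p - comb inj (c i) (et^~ p) -
  x i)).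
  by apply: stalk_sum => // i; apply: stalkZ => //; exact: th_Oring_inj.
have sy p : stalk EX p (y p) by apply: lift_stalkP; exact: Es.
have r0 : forall j, r j = 0.
  apply: fet; apply/H1rel_combP; exists (x0 - \sum_i inj (g i) *: x i) => p;
    rewrite rel.
  rewrite (_ : _ - _ = - (y p) - \sum_i inj (g i) *: (b i p -
    comb inj (c i) (et^~ p) - x i)).
    by apply: stalkB => //; rewrite -sub0r; apply: stalkB => //; exact: stalk0.
  by apply/rowP => j; rewrite !mxE; ring.
exists (x0 - \sum_i inj (g i) *: x i).
  move=> p; have := rel p; rewrite /comb big1 => [e0|j _];
    last by rewrite r0 rmorph0 scale0r.
  rewrite (_ : _ - _ = y p + \sum_i inj (g i) *: (b i p -
    comb inj (c i) (et^~ p) - x i)).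
    exact: stalkD.
  move/esym/eqP: e0; rewrite subr_eq0 => /eqP <-; apply/rowP => j;
    rewrite !mxE; ring.
rewrite map_mxB gresM_cst gresM_sum big1 ?subr0 => [|i _];
  last by rewrite map_mxZ rg scale0r.
by rewrite -mulmxA H'H mulmx1.
Qed.

End Deformation.

(** * Lifting a deformation along a surjection *)

Section Units.
Variables (F : fieldType) (C : curve F) (X : thickening C).
Local Notation T := (th_gen X).
Local Notation res := (th_res X).
Local Notation gres := (th_gres X).
Local Notation inj := (th_inj X).
Local Notation tcst := (th_cst X).
Local Notation gresM := (map_mx gres).
Local Notation O := (@Oring F C).
Local Notation TO := (@th_Oring F C X).

Lemma nilpotentD (a b : T) :
  (exists k, a ^+ k = 0) -> (exists k, b ^+ k = 0) ->
    exists k, (a + b) ^+ k = 0.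
Proof.
move=> [k ak] [l bl]; exists (k + l)%N; rewrite exprDn big1 // => i _.
have [il|li] := ltnP i l; last first.
  by rewrite -(subnK li) [b ^+ _]exprD bl !mulr0 mul0rn.
by rewrite -(subnK (_ : k <= k + l -
  i)%N) ?exprD ?ak ?mulr0 ?mul0r ?mul0rn //; lia.
Qed.

Lemma th_nilpotent (u : T) : gres u = 0 -> exists k, u ^+ k = 0.
Proof.
have [N [e [be bT]]] := exists_th_basis X.
move=> /(gres_kernel bT) ->.
apply: (big_ind (fun u => exists k, u ^+ k = 0)) => [|a b|i _].
- by exists 1%N; rewrite expr1.
- exact: nilpotentD.
have [|k hk] := @th_nil _ _ X (e i - th_str X (res (e i))).
  by rewrite rmorphB th_res_str subrr.
by exists k; rewrite exprMn -rmorphXn hk rmorph0 mul0r.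
Qed.

Lemma th_subring p : is_subring TO p.
Proof.
by have [N [e [be bT]]] := exists_th_basis X; exact: th_Oring_subring be bT p.
Qed.

(** [c] inverts [u] up to the nilpotent [v], and a finite geometric series in [v] corrects it
    without new denominators. *)
Lemma th_inverse (u : T) : gres u != 0 -> exists2 w, u * w = 1 &
  forall p, TO p u -> O p (gres u)^-1 -> TO p w.
Proof.
move=> u0; pose c := tcst (gres u)^-1; pose v := 1 - c * u.
have [|k vk] := @th_nilpotent v.
  by rewrite rmorphB rmorph1 rmorphM th_gres_cst mulVf // subrr.
exists (c * \sum_(i < k) v ^+ i) => [|p Tu Ou].
  have e := subrX1 v k; rewrite vk sub0r in e.
  have uc : c * u = 1 - v by rewrite /v subKr.
  by rewrite mulrCA mulrA uc -opprB mulNr -e opprK.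
have [T1 TB TM] := th_subring p; have Tc : TO p c by exact: th_Oring_cst.
have Tv : TO p v by apply: (TB) => //; exact: TM.
apply: (TM) => //; apply: (subring_sum (th_subring p)) => i _.
by elim: (i : nat) => [|j IH]; rewrite ?expr0 // exprS; exact: TM.
Qed.

Lemma th_inverse_mx n (M : 'M[T]_n) (B : 'M[C]_n) : gresM M *m B = 1%:M ->
  exists2 M', M *m M' = 1%:M &
    forall p, integral TO p M -> integral O p B -> integral TO p M'.
Proof.
move=> MB; have dMB : gres (\det M) * \det B = 1.
  by rewrite -det_map_mx -det_mulmx MB det1.
have d0 : gres (\det M) != 0.
  by apply: contra_eq_neq dMB => ->; rewrite mul0r eq_sym oner_neq0.
have [w Mw hw] := th_inverse d0; exists (w *: \adj M).
  by rewrite -scalemxAr mul_mx_adj scale_scalar_mx mulrC Mw.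
move=> p TM OB; apply: (integralZ (th_subring p)); last first.
  by apply: integral_adj => //; exact: th_subring.
apply: hw; first by apply: integral_det => //; exact: th_subring.
suff -> : (gres (\det M))^-1 = \det B by apply: integral_det => //;
  exact: Oring_subring.
by apply: (mulfI d0); rewrite mulfV.
Qed.

End Units.

Section Lifting.
Variables (F : fieldType) (C : curve F) (X' X : thickening C).
Variables (phi : {rmorphism th_base X' -> th_base X}).
Variables (psi : {rmorphism th_gen X' -> th_gen X}).
Hypothesis mor : th_morphism phi psi.
Local Notation O := (@Oring F C).
Local Notation TO := (@th_Oring F C X).
Local Notation TO' := (@th_Oring F C X').

(** [a] minus its residue is nilpotent, and so is its image, which therefore has residue 0. *)
Lemma th_res_morphism a : th_res X (phi a) = th_res X' a.
Proof.
have [mstr _ _] := mor.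
have [|k hk] := @th_nil _ _ X' (a - th_str X' (th_res X' a)).
  by rewrite rmorphB th_res_str subrr.
have := congr1 (th_res X \o phi) hk; rewrite /= !rmorphXn !rmorph0 => /eqP.
by rewrite expf_eq0 !rmorphB mstr th_res_str => /andP[_];
  rewrite subr_eq0 => /eqP.
Qed.

Lemma th_gres_morphism u : th_gres X (psi u) = th_gres X' u.
Proof.
have [N [e [be bT]]] := exists_th_basis X'; have [_ minj mcst] := mor.
rewrite (coE bT u) !rmorph_sum; apply: eq_bigr => i _.
by rewrite !rmorphM mcst minj !th_gres_cst !th_gres_inj th_res_morphism.
Qed.

Hypothesis phi_surj : forall a, exists a', phi a' = a.

(** Lift the basis elements and keep the coordinates. The section [L] need not be multiplicative, so
    lifted matrix identities hold only modulo the kernel of [psi]. *)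
Lemma exists_integral_lift : exists L : th_gen X -> th_gen X',
  cancel L psi /\ forall p u, TO p u -> TO' p (L u).
Proof.
have [N [e [be bT]]] := exists_th_basis X; have [_ minj mcst] := mor.
have [e' he'] := choice (fun i => phi_surj (e i)).
exists (fun u => \sum_i th_cst X' (co bT u i) * th_inj X' (e' i));
  split=> [u|p u].
  rewrite rmorph_sum [RHS](coE bT); apply: eq_bigr => i _.
  by rewrite rmorphM mcst minj he'.
move=> /(th_OringP be bT) hu; apply: (subring_sum (th_subring X' p)) => i _.
have [_ _ TM] := th_subring X' p; apply: TM; last exact: th_Oring_inj.
exact: th_Oring_cst.
Qed.

(** The naive lift [Z] of [cofr EX p] may spoil integrality of [Sg' *m Z]. As [Sg'] has a right
    inverse [R'], this product can be changed at will by a term in the kernel of [psi]. *)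
Lemma exists_lift_cofr (n k : nat) (EX : th_bundle X n) (Sg : 'M[th_gen X]_(k,
  n))
    (R : 'M[C]_(n, k)) :
  (forall p, integral TO p (Sg *m cofr EX p)) ->
    map_mx (th_gres X) Sg *m R = 1%:M ->
  exists (Sg' : 'M[th_gen X']_(k, n)) (c : place C -> 'M[th_gen X']_n),
    map_mx psi Sg' = Sg /\ forall p,
      [/\ map_mx psi (c p) = cofr EX p, integral TO' p (Sg' *m c p) &
          integral TO p (fr EX p) -> integral TO p (cofr EX p) ->
          integral TO' p (c p)].
Proof.
move=> ESg SgR; have [L [LK Lint]] := exists_integral_lift.
have LM m l (M : 'M_(m, l)) : map_mx psi (map_mx L M) = M.
  by apply/matrixP => i j; rewrite !mxE LK.
have LI p m l (M : 'M_(m, l)) : integral TO p M -> integral TO' p (map_mx L M).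
  by move=> hM i j; rewrite mxE; exact: Lint.
pose Sg' := map_mx L Sg.
have [R' SR'] : exists R', Sg' *m R' = 1%:M.
  have [|M hM _] := @th_inverse_mx _ _ X' _ (Sg' *m map_mx (th_cst X') R) 1%:M.
    rewrite mulmx1 map_mxM gresM_cst -SgR; congr (_ *m _).
    by apply/matrixP => i j; rewrite !mxE -th_gres_morphism LK.
  by exists (map_mx (th_cst X') R *m M); rewrite mulmxA.
suff /choice [c hc] : forall p, exists c,
    [/\ map_mx psi c = cofr EX p, integral TO' p (Sg' *m c) &
        integral TO p (fr EX p) -> integral TO p (cofr EX p) ->
          integral TO' p c].
  by exists Sg', c; split=> //; exact: LM.
move=> p; pose Z := map_mx L (cofr EX p).
(* At places where the frames are integral [Z] already works, and correcting by [R'], whose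
   integrality is not known, could destroy that of the lift. *)
have [[hf hc]|bad] := pselect (integral TO p (fr EX p) /\ integral TO p (cofr
  EX p)).
  exists Z; split; [exact: LM| |by move=> _ _; exact: LI].
  apply: (integralM (th_subring X' p)); last exact: LI.
  apply: LI; rewrite -[Sg]mulmx1 -(mulmx1C (fr_cofr EX p)) mulmxA.
  exact: (integralM (th_subring X p)).
pose Y := map_mx L (Sg *m cofr EX p).
exists (Z + R' *m (Y - Sg' *m Z)); split; last by move=> hf hc; case: bad.
  rewrite map_mxD map_mxM map_mxB map_mxM !LM.
  by rewrite subrr mulmx0 addr0.
rewrite mulmxDr mulmxA SR' mul1mx addrC subrK; exact: LI.
Qed.

Lemma exists_lift_bundle (n k : nat) (EX : th_bundle X n) (Sg : 'M[th_gen
  X]_(k, n))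
    (R : 'M[C]_(n, k)) :
  (forall p, integral TO p (Sg *m cofr EX p)) ->
    map_mx (th_gres X) Sg *m R = 1%:M ->
  exists (EX' : th_bundle X' n) (Sg' : 'M[th_gen X']_(k, n)),
    [/\ forall p, map_mx psi (fr EX' p) = fr EX p,
        forall p, map_mx psi (cofr EX' p) = cofr EX p,
        map_mx psi Sg' = Sg &
        forall p, integral TO' p (Sg' *m cofr EX' p)].
Proof.
move=> ESg SgR; have [Sg' [c [psiSg hc]]] := exists_lift_cofr ESg SgR.
have ginv p : map_mx (th_gres X') (c p) *m map_mx (th_gres X) (fr EX p) = 1%:M.
  have [pc _ _] := hc p;
    have := congr1 (map_mx (th_gres X)) (mulmx1C (fr_cofr EX p)).
  rewrite map_mxM map_mx1 => <-; congr (_ *m _).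
  by apply/matrixP => i j; rewrite -pc !mxE th_gres_morphism.
have /choice [f hf] p : exists f, c p *m f = 1%:M /\ forall q,
    integral TO' q (c p) -> integral O q (map_mx (th_gres X) (fr EX p)) ->
    integral TO' q f.
  by have [f ? ?] := th_inverse_mx (ginv p); exists f.
have fc p : f p *m c p = 1%:M by have [/mulmx1C] := hf p.
have ae : finite_set [set p | ~ (integral TO' p (f p) /\ integral TO' p (c p))].
  apply: sub_finite_set (bundle_ae EX) => p /= hp [i1 i2]; apply: hp.
  have [_ h1] := hf p; have [_ _ /(_ i1 i2) ic] := hc p.
  by split=> //; apply: h1 => //; exact: integral_gres.
exists (Bundle fc ae), Sg'; split=> // p; try by have [] := hc p.
  have [pc _ _] := hc p; rewrite -[LHS]mulmx1 -(mulmx1C (fr_cofr EX p)) mulmxA.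
  by rewrite -{1}pc -map_mxM fc map_mx1 mul1mx.
Qed.

End Lifting.

(** * Lifting points of the Brill-Noether scheme *)

Section Smoothness.
Variables (F : fieldType) (C : curve F) (n : nat) (E : vbundle C n).

Lemma bn_smooth_of_row_free k (t : 'I_k -> 'rV[C]_n) :
  generates (cst C) (H0 E) [set 0] t -> free_mod (cst C) [set 0] t ->
  row_free (\matrix_i t i) -> bn_smooth_at k E.
Proof.
move=> gt ft rft X' X phi psi mor phi_surj EX [[H [H' [HH' iso]]] fit].
have [N [e [be bT fe]]] := exists_flag_basis X.
have [N' [e' [be' bT' fe']]] := exists_flag_basis X'.
have H'H := mulmx1C HH'.
have h0k h0 : h0_eq E h0 -> h0 = k.
  move=> [s [gs fs]]; apply/eqP; rewrite eqn_leq.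
  by rewrite (free_le_generators gt (proj1 gs) fs) (free_le_generators gs
    (proj1 gt) ft).
have gresE m l (M : 'M[th_gen X']_(m, l)) :
    map_mx (th_gres X') M = map_mx (th_gres X) (map_mx psi M).
  by apply/matrixP => i j; rewrite !mxE (th_gres_morphism mor).
have lift_iso (EX' : th_bundle X' n) :
    (forall p, map_mx psi (fr EX' p) = fr EX p) ->
    (forall p, map_mx psi (cofr EX' p) = cofr EX p) ->
    (forall p, integral (@Oring F C) p (map_mx (th_gres X') (fr EX' p) *m H *m
      cofr E p) /\
      integral (@Oring F C) p (fr E p *m H' *m map_mx (th_gres X') (cofr EX'
        p))) /\
    pullback_iso psi EX' EX.
  move=> pf pc; split=> [p|]; first by rewrite !gresE pf pc; exact: iso.
  exists 1%:M, 1%:M; split=> [|p]; first by rewrite mulmx1.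
  rewrite pf pc !mulmx1 fr_cofr.
  by split; exact: integral_mx1 (th_subring X p) _.
have [[h1 [eb [geb feb]]]|noh1] := pselect (exists h1, h1_eq E h1); last first.
  have [||EX' [_ [pf pc _ _]]] :=
      @exists_lift_bundle _ _ _ _ _ _ mor phi_surj n 0 EX 0 0.
  - by move=> p [].
  - by apply/matrixP => -[].
  have [iso' psi_iso] := lift_iso EX' pf pc; exists EX' => //.
  split=> [|h0 h1 _ E1]; first by exists H, H'.
  by case: noh1; exists h1.
have get := lift_generates be bT HH' iso geb fe.
have fet : free_mod (th_inj X) (H1rel EX) (fun i => lift_adele X H' (eb i)).
  move=> c rel j.
  have h0E : h0_eq E k by exists t.
  have h1E : h1_eq E h1 by exists eb.
  (* With [h1] generators the minors have size 1, as [1 + (h1 + k) = h1 + k.+1]: each coefficient of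
     a relation is such a minor. *)
  have := fit k h1 h0E h1E h1 1%N _ (\row_i c i) (fun=> j) _ get.
  rewrite det_mx11 !mxE; apply; first by lia.
  move=> i; suff -> : (\row_i c i) i = c by exact: rel.
  by apply/funext => l; rewrite mxE.
have /choice [s hs] i : exists s, H0 EX s /\ map_mx (th_gres X) s *m H = t i.
  have [s ? ?] := lift_section be bT HH' iso get fet (proj1 gt i).
  by exists s.
pose Sg := \matrix_i s i.
have gSg : map_mx (th_gres X) Sg *m H = \matrix_i t i.
  apply/row_matrixP => i; rewrite row_mul -map_row !rowK.
  by have [] := hs i.
have [R tR] := row_freeP rft.
have [||EX' [Sg' [pf pc pSg ESg']]] :=
  @exists_lift_bundle _ _ _ _ _ _ mor phi_surj n k EX Sg (H *m R).
- move=> p i j; have [/(_ p 0 j) + _] := hs i.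
  by congr (th_Oring _ _); rewrite !mxE; apply: eq_bigr => l _; rewrite !mxE.
- by rewrite mulmxA gSg.
have [iso' psi_iso] := lift_iso EX' pf pc; exists EX' => //.
(* Uniqueness of dimension gives [h0 = k]; for [h1'] the argument simply runs with whichever basis
   [eb'] is given. *)
split=> [|h0 h1' E0 [eb' [geb' feb']]]; first by exists H, H'.
rewrite (h0k _ E0).
have get' := lift_generates be' bT' HH' iso' geb' fe'.
apply: (free_fitting_zero (H1rel_submodule_th be' bT' EX') get') => //.
  apply: (lift_free be' bT' HH' iso' fe' (s := fun i => row i Sg') feb' gt) =>
    i.
    by move=> p a j; rewrite -row_mul mxE; exact: ESg'.
  by rewrite map_row gresE pSg -row_mul gSg rowK.
lia.
Qed.

End Smoothness.

Theorem mainTheorem6 (R : realType) (C : curve R[i]) (g : nat)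
    (KC : vbundle C 1) (n : nat) (d : int) :
  has_genus C g -> canonical_bundle KC -> (0 < n)%N ->
  (forall E : vbundle C n,
     brill_noether 2 d E -> ~ brill_noether 3 d E -> second_type E ->
     petri_injective KC E) /\
  (@bn_sing _ C 2 n d `<=`
     @brill_noether _ C 3 n d `|`
     [set E | brill_noether 2 d E /\ first_type E]).
Proof.
move=> _ _ n0.
have key (E : vbundle C n) : brill_noether 2 d E -> ~ brill_noether 3 d E ->
    ~ first_type E -> exists t : 'I_2 -> 'rV[C]_n,
    [/\ generates (cst C) (H0 E) [set 0] t, free_mod (cst C) [set 0] t &
        row_free (\matrix_i t i)].
  move=> [Em [t [Et ft]]] nE3 nfirst.
  have gt : generates (cst C) (H0 E) [set 0] t.
    by apply: maximal_free_generates Et ft _ => h3; apply: nE3.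
  by exists t; split=> //; exact: (second_type_row_free n0 gt ft nfirst).
split=> [E E2 nE3 [_ nfirst]|E [E2 sing]].
  have [t [gt _ rft]] := key E E2 nE3 nfirst.
  exact: (petri_injective_of_row_free gt rft).
apply: contrapT => /not_orP [nE3 /not_andP [/(_ E2) []|nfirst]].
have [t [gt ft rft]] := key E E2 nE3 nfirst.
by apply: sing; exact: (bn_smooth_of_row_free gt ft rft).
Qed.
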